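(* For walks on the slit plane with diagonal steps $(1,1),(1,-1),(-1,1),(-1,-1)$, the complete generating function is $$S(x,y;t)=\frac{\left(1-8t^2(1+\bar x^2)+\sqrt{1-16t^2}\right)^{1/2}}{\sqrt2\left(1-t(x+\bar x)(y+\bar y)\right)},$$ where $\bar x=1/x$, $\bar y=1/y$, radicals are formal power series in $t$ with positive constant term, and the reciprocal is expanded in powers of $t$. This series is algebraic of degree $4$ over $\mathbb{Q}(x,y,t)$. At $x=y=1$, $$S(1,1;t)=\sum_{n\ge0}a(n)t^n=\frac{(1+4t)^{1/4}(1+\sqrt{1-16t^2})^{1/2}}{\sqrt2(1-4t)^{3/4}},$$ and as $n\to\infty$, $$a(n)\sim\frac{1}{2^{1/4}\Gamma(3/4)}\,4^nn^{-1/4}.$$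
   Context: Let $\mathcal H=\{(k,0):k\in\mathbb{Z},\,k\le0\}$. A walk of length $n$ with steps in $A\subset\mathbb{Z}^2$ is a sequence $(w_0,\dots,w_n)$ in $\mathbb{Z}^2$ with $w_m-w_{m-1}\in A$ for $1\le m\le n$. Here $A=\{(1,1),(1,-1),(-1,1),(-1,-1)\}$. A walk on the slit plane is such a walk with $w_0=(0,0)$ and $w_m\notin\mathcal H$ for $1\le m\le n$. Let $a_{i,j}(n)$ be the number of walks on the slit plane of length $n$ ending at $(i,j)$, $a(n)=\sum_{i,j}a_{i,j}(n)$, and $S(x,y;t)=\sum_{n\ge0}\sum_{i,j}a_{i,j}(n)x^iy^jt^n$. *)

(* Defs.v *)
From HB Require Import structures.
From mathcomp Require Import all_boot all_order all_algebra.
From mathcomp Require Import all_classical all_reals all_analysis.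
Set Implicit Arguments. Unset Strict Implicit. Unset Printing Implicit Defensive.
Import Order.TTheory GRing.Theory Num.Theory.
Local Open Scope ring_scope.

Definition stepx (s : bool * bool) : int := if s.1 then 1 else -1.
Definition stepy (s : bool * bool) : int := if s.2 then 1 else -1.

(* a walk of length n from (0,0) is determined by its step sequence;
   pos s m = w_m (for m <= n) *)
Definition pos (n : nat) (s : {ffun 'I_n -> bool * bool}) (m : nat) : int * int :=
  (\sum_(k < n | (k < m)%N) stepx (s k), \sum_(k < n | (k < m)%N) stepy (s k)).

Definition inH (p : int * int) : bool := (p.2 == 0) && (p.1 <= 0).

Definition slit (n : nat) (s : {ffun 'I_n -> bool * bool}) : bool :=
  [forall m : 'I_n, ~~ inH (pos s m.+1)].

Definition acount (n : nat) (i j : int) : nat :=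
  #|[set s : {ffun 'I_n -> bool * bool} | slit s && (pos s n == (i, j))]|.

(* a(n) = sum_{i,j} a_{i,j}(n); endpoints of length-n walks satisfy |i|,|j| <= n *)
Definition atotal (n : nat) : nat :=
  (\sum_(k < (2 * n).+1) \sum_(l < (2 * n).+1)
     acount n (k%:Z - n%:Z) (l%:Z - n%:Z))%N.

Definition fps (R : Type) := nat -> R.

Section FPS.
Variable R : comNzRingType.
Definition fps_of_poly (p : {poly R}) : fps R := fun n => p`_n.
Definition fps_add (f g : fps R) : fps R := fun n => f n + g n.
Definition fps_scale (c : R) (f : fps R) : fps R := fun n => c * f n.
Definition fps_mul (f g : fps R) : fps R :=
  fun n => \sum_(k < n.+1) f k * g (n - k)%N.
Definition fps_pow (f : fps R) (k : nat) : fps R :=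
  iter k (fps_mul f) (fps_of_poly 1).
Definition fps_zero : fps R := fun _ => 0.
Definition fps_eval (P : {poly {poly R}}) (f : fps R) : fps R :=
  fun n => \sum_(k < size P) fps_mul (fps_of_poly P`_k) (fps_pow f k) n.
End FPS.

Definition K := {fraction {poly {poly rat}}}.
Definition xK : K := tofrac (('X : {poly rat})%:P).
Definition yK : K := tofrac ('X : {poly {poly rat}}).

Definition Sser : fps K := fun n =>
  \sum_(k < (2 * n).+1) \sum_(l < (2 * n).+1)
     (acount n (k%:Z - n%:Z) (l%:Z - n%:Z))%:R
       * xK ^ (k%:Z - n%:Z) * yK ^ (l%:Z - n%:Z).

Definition Aser : fps rat := fun n => (atotal n)%:R.

Definition Gamma (R : realType) (s : R) : R :=
  fine (\int[@lebesgue_measure R]_(u in `]0%R, +oo[%classic)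
          (powR u (s - 1) * expR (- u))%:E)%E.

(* Main.v *)
(* Count a diagonal walk by its numbers of steps to the right (exponent of X) and
   upwards (exponent of Y).  With this bookkeeping S = q / (1 - t (1+X)(1+Y)),
   where q is a series in X and Y t^2, is equivalent to two facts: the source q
   is supported on the half-line H, and the coefficients of S on H vanish for
   positive length.  The first is a degree bound.  For the second, the terms of S
   on the line y = 0 are the coefficients of q / sqrt (1 - 4 T (1+X)^2), and an
   explicit square root shows that this product is a series in X T whose higher
   coefficients have no constant term.

   For the degree, 2 q^2 = alpha + r with r^2 = rho: neither rho nor the norm
   alpha^2 - rho is a square in F(t), since both have a simple root.

   For the asymptotics, a(n) / 4^n only depends on m = floor (n/2); its series e
   in T satisfies 2 e^2 = (1-T)^(-1) + (1-T)^(-3/2), so that e = (1-T)^(-3/4) w with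
   w(1) = 1/sqrt 2 and 1 - w nonnegative.  Since the coefficients of
   (1-T)^(-3/4) decrease, one first shows that (1-T)^(-7/4) w has coefficients
   asymptotic to w(1) times those of (1-T)^(-7/4), and transfers this to e by the
   linear differential equation of e.  Finally the n-th coefficient of
   (1-T)^(-3/4), times Gamma(3/4) n!, is the integral of u^(n-1/4) exp(-u), which
   lies between n! (n+1)^(-1/4) and n! n^(-1/4). *)
Require Import Defs.
From HB Require Import structures.
From mathcomp Require Import all_boot all_order all_algebra.
From mathcomp Require Import all_classical all_reals all_analysis.
From mathcomp Require Import measurable_realfun ring lra zify.
Import Order.TTheory GRing.Theory Num.Theory numFieldNormedType.Exports.
Local Open Scope classical_set_scope.
Local Open Scope ring_scope.
Set Implicit Arguments. Unset Strict Implicit. Unset Printing Implicit Defensive.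

(** * The ring of formal power series *)

HB.instance Definition _ (R : Type) := gen_eqMixin (fps R).
HB.instance Definition _ (R : Type) := gen_choiceMixin (fps R).

Section FpsRing.
Variable R : comNzRingType.
Implicit Types f g h : fps R.

Lemma fpsP f g : f =1 g -> f = g.
Proof. by move=> fg; apply: funext. Qed.

Definition fps_opp f : fps R := fun n => - f n.

Lemma fps_addA : associative (@fps_add R).
Proof. by move=> f g h; apply: fpsP => n; exact: addrA. Qed.
Lemma fps_addC : commutative (@fps_add R).
Proof. by move=> f g; apply: fpsP => n; exact: addrC. Qed.
Lemma fps_add0 : left_id (fps_zero R) (@fps_add R).
Proof. by move=> f; apply: fpsP => n; exact: add0r. Qed.
Lemma fps_addN : left_inverse (fps_zero R) fps_opp (@fps_add R).
Proof. by move=> f; apply: fpsP => n; exact: addNr. Qed.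

HB.instance Definition _ :=
  GRing.isZmodule.Build (fps R) fps_addA fps_addC fps_add0 fps_addN.

Definition fps_trunc n f : {poly R} := \poly_(i < n.+1) f i.

Lemma fps_mul_trunc n k f g : (k <= n)%N ->
  fps_mul f g k = (fps_trunc n f * fps_trunc n g)`_k.
Proof.
move=> kn; rewrite coefM; apply: eq_bigr => i _.
by rewrite !coef_poly !ltnS !ifT // (leq_trans _ kn) ?leq_subr // -ltnS.
Qed.

Lemma fps_mulC : commutative (@fps_mul R).
Proof.
move=> f g; apply: fpsP => n.
by rewrite (@fps_mul_trunc n n f g) // (@fps_mul_trunc n n g f) // mulrC.
Qed.

Lemma fps_mulA : associative (@fps_mul R).
Proof.
move=> f g h; apply: fpsP => n.
have tM u v k : (k <= n)%N -> fps_mul u v k = (fps_trunc n u * fps_trunc n v)`_k.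
  exact: fps_mul_trunc.
have tE u k : (k <= n)%N -> u k = (fps_trunc n u)`_k.
  by move=> kn; rewrite coef_poly ltnS kn.
transitivity ((fps_trunc n f * (fps_trunc n g * fps_trunc n h))`_n).
  rewrite coefM; apply: eq_bigr => i _.
  by rewrite tM ?leq_subr // tE // -ltnS.
rewrite mulrA coefM; apply: eq_bigr => i _.
by rewrite tM -1?ltnS // (tE h) ?leq_subr.
Qed.

Lemma fps_mul1 : left_id (fps_of_poly 1) (@fps_mul R).
Proof.
move=> f; apply: fpsP => n; rewrite /fps_mul big_ord_recl big1 ?addr0.
  by rewrite /fps_of_poly coef1 mul1r subn0.
by move=> i _; rewrite /fps_of_poly coef1 mul0r.
Qed.

Lemma fps_mulDl : left_distributive (@fps_mul R) (@fps_add R).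
Proof.
move=> f g h; apply: fpsP => n; rewrite /fps_mul /fps_add -big_split /=.
by apply: eq_bigr => i _; rewrite mulrDl.
Qed.

Lemma fps_oner_neq0 : fps_of_poly 1 != 0 :> fps R.
Proof.
apply/eqP => /(congr1 (fun f : fps R => f 0%N)).
by rewrite /fps_of_poly coef1 => /eqP; rewrite oner_eq0.
Qed.

HB.instance Definition _ := GRing.Zmodule_isComNzRing.Build (fps R)
  fps_mulA fps_mulC fps_mul1 fps_mulDl fps_oner_neq0.

Lemma fpsMn f g n : (f * g) n = \sum_(k < n.+1) f k * g (n - k)%N. Proof. by []. Qed.
Lemma fpsDn f g n : (f + g) n = f n + g n. Proof. by []. Qed.
Lemma fpsNn f n : (- f) n = - f n. Proof. by []. Qed.
Lemma fpsBn f g n : (f - g) n = f n - g n. Proof. by []. Qed.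
Lemma fps1n n : (1 : fps R) n = (n == 0%N)%:R.
Proof. by rewrite -[LHS]/((1 : {poly R})`_n) coef1. Qed.

Lemma fpsMn0 f g : (f * g) 0%N = f 0%N * g 0%N.
Proof. by rewrite fpsMn big_ord1. Qed.

Lemma fpsXn0 f k : (f ^+ k) 0%N = f 0%N ^+ k.
Proof.
elim: k => [|k IHk]; first by rewrite !expr0 fps1n.
by rewrite !exprS fpsMn0 IHk.
Qed.

Lemma fps_powE f k : fps_pow f k = f ^+ k.
Proof. by elim: k => // k IHk; rewrite exprS -IHk. Qed.

Lemma fps_of_poly_is_zmod_morphism : zmod_morphism (@fps_of_poly R).
Proof. by move=> p q; apply: fpsP => n; exact: coefB. Qed.

Lemma fps_of_poly_is_monoid_morphism : monoid_morphism (@fps_of_poly R).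
Proof. by split=> // p q; apply: fpsP => n; exact: coefM. Qed.

HB.instance Definition _ := GRing.isZmodMorphism.Build {poly R} (fps R)
  (@fps_of_poly R) fps_of_poly_is_zmod_morphism.
HB.instance Definition _ := GRing.isMonoidMorphism.Build {poly R} (fps R)
  (@fps_of_poly R) fps_of_poly_is_monoid_morphism.

Lemma fps_of_poly_inj : injective (@fps_of_poly R).
Proof. by move=> p q pq; apply/polyP => n; rewrite -[LHS]/(fps_of_poly p n) pq. Qed.

Lemma fps_scaleE c f : fps_scale c f = fps_of_poly c%:P * f.
Proof.
apply: fpsP => n; rewrite fpsMn big_ord_recl big1 ?addr0 /fps_of_poly ?coefC ?subn0 //.
by move=> i _; rewrite coefC mul0r.
Qed.

Lemma fps_evalE (P : {poly {poly R}}) f :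
  fps_eval P f = (map_poly (@fps_of_poly R) P).[f].
Proof.
apply: fpsP => n; rewrite horner_poly /fps_eval.
have sumn (F : nat -> fps R) m :
    (\sum_(k < m) F k) n = \sum_(k < m) F k n.
  by elim: m => [|m IHm]; rewrite ?big_ord0 // !big_ord_recr /= fpsDn IHm.
rewrite (sumn (fun k => fps_of_poly P`_k * f ^+ k)).
by apply: eq_bigr => k _; rewrite fps_powE.
Qed.

(** Course-of-values recursion: entry k of the iterates started at zero is final after k + 1 rounds,
    so the diagonal of the iterates is a fixed point. *)
Lemma fps_fixpoint (phi : nat -> (nat -> R) -> R) :
  (forall n u v, (forall k, (k < n)%N -> u k = v k) -> phi n u = phi n v) ->
  exists g : fps R, forall n, g n = phi n g.
Proof.
move=> phiE; pose F (g : nat -> R) k := phi k g.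
pose G m := iter m F (fun=> 0).
have GE m k : (k < m)%N -> G m k = G k.+1 k.
  elim/ltn_ind: k m => k IHk [//|m] km; apply: phiE => j jk.
  rewrite -[LHS]/(G m j) -[RHS]/(G k j) (IHk j jk m) ?(leq_trans jk) //.
  exact/esym/IHk.
exists (fun n => G n.+1 n) => n.
by rewrite -[LHS]/(phi n (G n)); apply: phiE => k kn; apply: GE.
Qed.

Lemma fps_inv_exists f : f 0%N = 1 -> exists g, g 0%N = 1 /\ f * g = 1.
Proof.
move=> f0; pose phi n (u : nat -> R) :=
  (n == 0%N)%:R - \sum_(k < n) f k.+1 * u (n - k.+1)%N.
have [|g gE] := @fps_fixpoint phi.
  move=> n u v uv; congr (_ - _); apply: eq_bigr => k _; rewrite uv //.
  by have := ltn_ord k; lia.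
exists g; split; first by rewrite gE /phi big_ord0 subr0.
apply: fpsP => n; rewrite fpsMn big_ord_recl f0 mul1r subn0 gE /phi fps1n.
by rewrite subrK.
Qed.

(** Coefficient n + 1 of g * g is 2 g(n+1) plus products of earlier coefficients. The element [c]
    stands for 1/2, so that polynomial coefficient rings are covered. *)
Lemma fps_sqrt_exists (c : R) f : c *+ 2 = 1 -> f 0%N = 1 ->
  exists g, g 0%N = 1 /\ g * g = f.
Proof.
move=> c2 f0; pose phi n (u : nat -> R) :=
  if n is m.+1 then (f n - \sum_(k < m) u k.+1 * u (m - k)%N) * c else 1.
have [|g gE] := @fps_fixpoint phi.
  case=> // n u v uv; congr ((_ - _) * _); apply: eq_bigr => k _.
  by rewrite !uv //; have := ltn_ord k; lia.
have g0 : g 0%N = 1 by rewrite gE.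
exists g; split=> //; apply: fpsP => -[|n]; first by rewrite fpsMn0 g0 mulr1 f0.
rewrite fpsMn big_ord_recl big_ord_recr /= g0 mul1r subn0 /bump /= add1n subnn g0 mulr1.
have -> : \sum_(i < n) g (1 + i)%N * g (n.+1 - (1 + i))%N
   = \sum_(k < n) g k.+1 * g (n - k)%N by apply: eq_bigr.
rewrite addrCA -mulr2n gE /phi -mulrnAr c2 mulr1 addrC subrK //.
Qed.

End FpsRing.

Section FpsIdomain.
Variable R : idomainType.
Implicit Types f g : fps R.

(** Let m be the order of f. By strong induction on n, coefficient m + n of the product reduces to
    f(m) g(n). *)
Lemma fps_mulf_eq0 f g : f * g = 0 -> f = 0 \/ g = 0.
Proof.
move=> fg0; have [->|/eqP f0] := eqVneq f 0; [by left | right].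
have exf : exists n, f n != 0.
  apply: contrapT => f0'; apply: f0; apply: fpsP => n; apply: contrapT => /eqP fn.
  by apply: f0'; exists n.
case: (ex_minnP exf) => m fm mmin.
apply: fpsP; elim/ltn_ind => n IHn.
have := congr1 (fun h : fps R => h (m + n)%N) fg0.
rewrite /= fpsMn (bigD1 (inord m : 'I_(m + n).+1)) //= inordK ?ltnS ?leq_addr //.
rewrite addKn big1 ?addr0.
  by move=> /eqP; rewrite mulf_eq0 (negPf fm) => /eqP.
move=> i /eqP im; have [lim|] := ltnP i m.
  have [->|/mmin] := eqVneq (f i) 0; first by rewrite mul0r.
  by rewrite leqNgt lim.
rewrite leq_eqVlt => /orP[/eqP mi|mi].
  by case: im; apply: val_inj; rewrite /= inordK ?ltnS ?leq_addr.
by rewrite IHn ?mulr0 //; have := ltn_ord i; lia.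
Qed.

Lemma fps_mulIf f g h : f 0%N != 0 -> g * f = h * f -> g = h.
Proof.
move=> f0 /eqP; rewrite -subr_eq0 -mulrBl => /eqP /fps_mulf_eq0[/eqP|f00].
  by rewrite subr_eq0 => /eqP.
by rewrite f00 eqxx in f0.
Qed.

(** Radicals are identified this way below: in (f - g)(f + g) = 0 the second factor has constant
    term 2. *)
Lemma fps_sqr_inj f g : 2%:R != 0 :> R -> f 0%N = 1 -> g 0%N = 1 ->
  f * f = g * g -> f = g.
Proof.
move=> n2 f0 g0 fg; have : (f - g) * (f + g) = 0 by rewrite -subr_sqr !expr2 fg subrr.
move=> /fps_mulf_eq0[/eqP|/(congr1 (fun h : fps R => h 0%N))].
  by rewrite subr_eq0 => /eqP.
by rewrite /= fpsDn f0 g0 => /eqP; rewrite (negPf n2).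
Qed.

End FpsIdomain.

(** * Substitutions as ring morphisms, and chosen square roots *)

Section FpsMorphisms.
Variables (R S : comNzRingType) (phi : {rmorphism R -> S}) (c : S).

(** Change of coefficients combined with the substitution t := c t; together with t := t^2
    ([fps_sqvar]) it expresses all specialisations below. *)
Definition fps_map_scale (f : fps R) : fps S := fun n => phi (f n) * c ^+ n.

Lemma fps_map_scale_is_zmod_morphism : zmod_morphism fps_map_scale.
Proof.
by move=> f g; apply: fpsP => n; rewrite /fps_map_scale !fpsBn rmorphB mulrBl.
Qed.

Lemma fps_map_scale_is_monoid_morphism : monoid_morphism fps_map_scale.
Proof.
split=> [|f g]; apply: fpsP => n; rewrite /fps_map_scale.
  by rewrite !fps1n rmorph_nat; case: n => [|n]; rewrite ?mulr1 ?mul0r.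
rewrite !fpsMn rmorph_sum mulr_suml; apply: eq_bigr => k _.
rewrite rmorphM mulrACA -exprD subnKC //; exact: ltn_ord k.
Qed.

HB.instance Definition _ := GRing.isZmodMorphism.Build (fps R) (fps S)
  fps_map_scale fps_map_scale_is_zmod_morphism.
HB.instance Definition _ := GRing.isMonoidMorphism.Build (fps R) (fps S)
  fps_map_scale fps_map_scale_is_monoid_morphism.

End FpsMorphisms.

Section FpsSquareVar.
Variable R : comNzRingType.

Definition fps_sqvar (f : fps R) : fps R := fun n => if odd n then 0 else f n./2.

Lemma fps_sqvar_double f n : fps_sqvar f n.*2 = f n.
Proof. by rewrite /fps_sqvar odd_double doubleK. Qed.

Lemma fps_sqvar_is_zmod_morphism : zmod_morphism fps_sqvar.
Proof.
by move=> f g; apply: fpsP => n; rewrite /fps_sqvar !fpsBn; case: odd; rewrite ?subr0.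
Qed.

Lemma sum_ord_even (V : nmodType) (F : nat -> V) n :
  (forall k, odd k -> F k = 0) ->
  \sum_(k < n.+1) F k = \sum_(k < n./2.+1) F k.*2.
Proof.
move=> Fodd; elim/ltn_ind: n => -[|[|n]] IHn; first by rewrite !big_ord1.
  by rewrite big_ord_recr !big_ord1 /= (Fodd 1%N) // addr0.
rewrite 2!big_ord_recr IHn //= [RHS]big_ord_recr /= -addrA; congr (_ + _).
have nE := odd_double_half n; have [on|en] := boolP (odd n).
  rewrite (Fodd n.+2) /= ?negbK // addr0; congr F.
  by rewrite -{1}nE on doubleS.
rewrite (Fodd n.+1) //= add0r; congr F.
by rewrite -{1}nE (negPf en) doubleS.
Qed.

Lemma fps_sqvar_is_monoid_morphism : monoid_morphism fps_sqvar.
Proof.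
split=> [|f g]; apply: fpsP => n.
  by rewrite /fps_sqvar !fps1n; case: n => [//|[//|n]]; case: odd.
rewrite [RHS]fpsMn {1}/fps_sqvar.
have [on|en] := boolP (odd n).
  rewrite big1 // => k _; rewrite /fps_sqvar oddB; last exact: (ltn_ord k).
  rewrite on.
  by case: (odd k); rewrite ?mul0r ?mulr0.
rewrite (@sum_ord_even _ (fun k => fps_sqvar f k * fps_sqvar g (n - k)%N)); last first.
  by move=> k ok; rewrite /fps_sqvar ok mul0r.
rewrite fpsMn; apply: eq_bigr => k _; rewrite fps_sqvar_double.
have -> : (n - k.*2)%N = (n./2 - k).*2 by rewrite doubleB even_halfK.
by rewrite fps_sqvar_double.
Qed.

HB.instance Definition _ := GRing.isZmodMorphism.Build (fps R) (fps R)
  fps_sqvar fps_sqvar_is_zmod_morphism.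
HB.instance Definition _ := GRing.isMonoidMorphism.Build (fps R) (fps R)
  fps_sqvar fps_sqvar_is_monoid_morphism.

End FpsSquareVar.

Section FpsSqrt.
Variable R : comNzRingType.

(** The value is the default 1 when no root with constant term 1 exists; [fps_sqrtP] gives the cases
    where one does. *)
Definition fps_sqrt (f : fps R) : fps R :=
  xget (1 : fps R) [set g : fps R | g 0%N = 1 /\ g * g = f].

Lemma fps_sqrtP (c : R) f : c *+ 2 = 1 -> f 0%N = 1 ->
  fps_sqrt f 0%N = 1 /\ fps_sqrt f * fps_sqrt f = f.
Proof.
move=> c2 f0.
by have /(xgetPex 1) [g0 gg] := fps_sqrt_exists c2 f0; split.
Qed.

Lemma fps_of_polyCn (c : R) n : fps_of_poly c%:P n = if n == 0%N then c else 0.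
Proof. exact: coefC. Qed.

Lemma fps_natr0 (k : nat) : (k%:R : fps R) 0%N = k%:R.
Proof. by elim: k => // k IHk; rewrite !mulrS fpsDn IHk fps1n. Qed.

Lemma fps_of_polyX0 : fps_of_poly 'X 0%N = 0 :> R.
Proof. by rewrite /fps_of_poly coefX. Qed.

Lemma fpsXS f n : (fps_of_poly 'X * f) n.+1 = f n :> R.
Proof.
rewrite fpsMn big_ord_recl big_ord_recl big1 => [|i _].
  by rewrite /fps_of_poly /bump /= !coefX mul0r mul1r add0r addr0 subSS subn0.
by rewrite /fps_of_poly coefX mul0r.
Qed.

Lemma fpsXM0 f : (fps_of_poly 'X * f) 0%N = 0 :> R.
Proof. by rewrite fpsMn0 fps_of_polyX0 mul0r. Qed.

Lemma fpsCM (c : R) f n : (fps_of_poly c%:P * f) n = c * f n.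
Proof. by rewrite -fps_scaleE. Qed.

End FpsSqrt.

Section FpsMapScale.
Variables (R S : comNzRingType) (phi : {rmorphism R -> S}) (c : S).

Lemma fps_map_scale0 f : fps_map_scale phi c f 0%N = phi (f 0%N).
Proof. by rewrite /fps_map_scale expr0 mulr1. Qed.

Lemma fps_map_scaleC a :
  fps_map_scale phi c (fps_of_poly a%:P) = fps_of_poly (phi a)%:P.
Proof.
apply: fpsP => -[|n]; rewrite /fps_map_scale !fps_of_polyCn /= ?mulr1 //.
by rewrite rmorph0 mul0r.
Qed.

Lemma fps_map_scaleX :
  fps_map_scale phi c (fps_of_poly 'X) = fps_of_poly c%:P * fps_of_poly 'X.
Proof.
apply: fpsP => n; rewrite fpsCM /fps_map_scale /fps_of_poly !coefX rmorph_nat.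
by case: eqP => [->|_]; rewrite ?mulr1 ?mul1r ?mulr0 ?mul0r.
Qed.

End FpsMapScale.

Lemma fps_sqvarC (R : comNzRingType) (a : R) :
  fps_sqvar (fps_of_poly a%:P) = fps_of_poly a%:P.
Proof.
apply: fpsP => -[|[|n]]; rewrite /fps_sqvar !fps_of_polyCn //=.
by case: (odd n).
Qed.

Lemma fps_sqvarX (R : comNzRingType) :
  fps_sqvar (fps_of_poly 'X) = fps_of_poly 'X * fps_of_poly 'X :> fps R.
Proof.
rewrite -rmorphM /=; apply: fpsP => n.
rewrite /fps_sqvar /fps_of_poly coefMX !coefX.
by case: n => [|[|[|[|n]]]] //=; rewrite ?if_same.
Qed.

(** * The binomial series *)

Section BinomialSeries.
Variable F : numFieldType.
Implicit Types a b : F.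

(* The coefficients of (1 - t)^(-a). *)
Definition binser a : fps F := fun n => \prod_(i < n) ((a + i%:R) / i.+1%:R).

Lemma binser0 a : binser a 0%N = 1. Proof. by rewrite /binser big_ord0. Qed.

Lemma binserS a n : binser a n.+1 = binser a n * ((a + n%:R) / n.+1%:R).
Proof. by rewrite /binser big_ord_recr. Qed.

Lemma binserSE a n : n.+1%:R * binser a n.+1 = (a + n%:R) * binser a n.
Proof. by rewrite binserS mulrC -mulrA divfK ?pnatr_eq0 // mulrC. Qed.

(** The Euler operator t d/dt: a derivation that leaves indices in place. *)
Definition fps_euler (R : comNzRingType) (f : fps R) : fps R := fun n => n%:R * f n.

Lemma fps_eulerD (R : comNzRingType) (f g : fps R) :
  fps_euler (f + g) = fps_euler f + fps_euler g.
Proof. by apply: fpsP => n; rewrite /fps_euler !fpsDn mulrDr. Qed.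

Lemma fps_eulerM (R : comNzRingType) (f g : fps R) :
  fps_euler (f * g) = fps_euler f * g + f * fps_euler g.
Proof.
apply: fpsP => n; rewrite fpsDn /fps_euler !fpsMn mulr_sumr -big_split /=.
apply: eq_bigr => k _; rewrite -[in n%:R](@subnKC k n) ?natrD; last exact: (ltn_ord k).
ring.
Qed.

Lemma fps_euler_binser a :
  fps_euler (binser a) = fps_of_poly a%:P * (fps_of_poly 'X * binser (a + 1)).
Proof.
apply: fpsP => -[|n]; rewrite fpsCM /fps_euler ?fpsXM0 ?fpsXS ?mul0r ?mulr0 //.
rewrite binserSE; elim: n => [|n IHn]; first by rewrite !binser0 addr0.
apply: (@mulfI _ n.+1%:R); first by rewrite pnatr_eq0.
rewrite mulrCA binserSE IHn [RHS]mulrCA binserSE -!natr1; ring.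
Qed.

(** Both sides satisfy (n+1) c(n+1) = (a+b+n) c(n): for the product, apply the Leibniz rule and the
    recurrence of each factor. *)
Lemma binserD a b : binser a * binser b = binser (a + b).
Proof.
apply: fpsP; elim=> [|n IHn]; first by rewrite fpsMn0 !binser0 mulr1.
apply: (@mulfI _ n.+1%:R); first by rewrite pnatr_eq0.
rewrite binserSE -IHn.
have -> : n.+1%:R * (binser a * binser b) n.+1 = fps_euler (binser a * binser b) n.+1 by [].
rewrite fps_eulerM fpsDn.
have eS c : fps_euler (binser c) 0%N = 0 by rewrite /fps_euler mul0r.
rewrite [X in X + _]fpsMn big_ord_recl /= eS mul0r add0r.
rewrite [X in _ + X]fpsMn [X in _ + X]big_ord_recr /= subnn eS mulr0 addr0.
rewrite -big_split fpsMn mulr_sumr /=; apply: eq_bigr => k _.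
rewrite /bump /= add1n subSS [in (n.+1 - k)%N]subSn; last by rewrite -ltnS.
rewrite /fps_euler !binserSE.
have -> : n%:R = k%:R + (n - k)%:R :> F by rewrite -natrD subnKC // -ltnS.
ring.
Qed.

Lemma binser1 n : binser 1 n = 1.
Proof.
rewrite /binser big1 // => i _; rewrite addrC natr1 divff // pnatr_eq0.
Qed.

Lemma binser1_inv : binser 1 * (1 - fps_of_poly 'X) = 1.
Proof.
apply: fpsP => -[|n]; rewrite mulrBr mulr1 fpsBn mulrC.
  by rewrite fpsXM0 subr0 binser0 fps1n.
by rewrite fpsXS !binser1 subrr fps1n.
Qed.

Lemma central_binomialE n : 4%:R ^+ n * binser (2%:R^-1) n = 'C(n.*2, n)%:R.
Proof.
elim: n => [|n IHn]; first by rewrite binser0 bin0 mulr1.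
apply: (@mulfI _ n.+1%:R); first by rewrite pnatr_eq0.
rewrite exprS -mulrA mulrCA (mulrCA n.+1%:R) binserSE.
have -> : n.+1%:R * 'C(n.+1.*2, n.+1)%:R = 2 * n.*2.+1%:R * 'C(n.*2, n)%:R :> F.
  rewrite -!natrM; congr (_%:R).
  rewrite doubleS -mul_bin_diag /= -(@bin_sub n.*2.+1 n); last by lia.
  have -> : (n.*2.+1 - n = n.+1)%N by lia.
  by have := mul_bin_diag n.*2.+1 n; rewrite /=; lia.
rewrite -IHn; have -> : n.*2.+1%:R = 2 * n%:R + 1 :> F by rewrite -natrM mul2n natr1.
by field.
Qed.

End BinomialSeries.

(** * The Wiener-Hopf factor *)

(** The bound [degree of coefficient n is at most n] is stable under products, and the recursion for
    2 g(n+1) involves only f(n+1) and products g(k+1) g(n-k). *)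
Lemma sqrt_degree (R : idomainType) (f g : fps {poly R}) :
  2%:R != 0 :> R -> g 0%N = 1 -> g * g = f ->
  (forall n, (size (f n) <= n.+1)%N) -> forall n, (size (g n) <= n.+1)%N.
Proof.
move=> n2 g0 gg fdeg; elim/ltn_ind => -[|n] IHn; first by rewrite g0 size_poly1.
have : 2%:R *: g n.+1 = f n.+1 - \sum_(k < n) g k.+1 * g (n - k)%N.
  rewrite -gg fpsMn big_ord_recl big_ord_recr /= g0 mul1r subn0 /bump /= add1n subnn.
  rewrite g0 mulr1 scaler_nat.
  have -> : \sum_(i < n) g (1 + i)%N * g (n.+1 - (1 + i))%N
      = \sum_(k < n) g k.+1 * g (n - k)%N by apply: eq_bigr.
  by ring.
move=> E; rewrite -(size_scale _ n2) E.
rewrite (leq_trans (size_polyD _ _)) // size_polyN geq_max fdeg /=.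
rewrite (leq_trans (size_sum _ _ _)) //; apply/bigmax_leqP => k _.
rewrite (leq_trans (size_polyMleq _ _)) //.
have := IHn k.+1; have := IHn (n - k)%N; have := ltn_ord k; lia.
Qed.

Local Notation Tv := (fps_of_poly 'X).

Definition Psqrt : fps rat := fps_sqrt (1 - 16%:R * Tv).

Lemma PsqrtP : Psqrt 0%N = 1 /\ Psqrt * Psqrt = 1 - 16%:R * Tv.
Proof.
apply: (@fps_sqrtP _ (2%:R^-1)); first by [].
by rewrite fpsBn fps1n fpsMn0 fps_of_polyX0 mulr0 subr0.
Qed.

Local Notation QX := {poly rat}.
Local Notation fcst c := (fps_of_poly c%:P).
Local Notation xP := (fps_of_poly 'X%:P : fps QX).

Lemma polyr_half : (2%:R^-1 : rat)%:P *+ 2 = 1 :> QX.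
Proof. by rewrite -polyCMn. Qed.

Lemma poly2_neq0 : 2%:R != 0 :> QX.
Proof. by rewrite -polyC_natr polyC_eq0. Qed.

(** With X = x^2 and T = t^2 / x^2 one has t^2 = X T, so sqrt (1 - 16 t^2) becomes sqrt (1 - 16 X
    T). *)
Definition PsqrtX : fps QX := fps_map_scale (@polyC rat) 'X Psqrt.

Lemma PsqrtX0 : PsqrtX 0%N = 1.
Proof. by rewrite /PsqrtX fps_map_scale0 PsqrtP.1. Qed.

Lemma PsqrtX_sqr : PsqrtX * PsqrtX = 1 - 16%:R * xP * Tv.
Proof.
by rewrite /PsqrtX -rmorphM PsqrtP.2 rmorphB rmorph1 rmorphM rmorph_nat /= fps_map_scaleX mulrA.
Qed.

(* The slit-plane factor q of the closed form, in the variables X = x^2 and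
   t^2 / x^2: its n-th coefficient is x^(2n) [t^(2n)] q. *)
Definition WHfactor : fps QX :=
  fps_sqrt (fcst (2%:R^-1 : rat)%:P * (1 - 8%:R * Tv * (1 + xP) + PsqrtX)).

Lemma WHfactorP : WHfactor 0%N = 1 /\
  WHfactor * WHfactor = fcst (2%:R^-1 : rat)%:P * (1 - 8%:R * Tv * (1 + xP) + PsqrtX).
Proof.
apply: (fps_sqrtP polyr_half).
rewrite fpsCM !(fpsDn, fpsNn) !fpsMn0 fps_of_polyX0 fps1n mulr0 mul0r subr0 PsqrtX0.
by rewrite -mulr2n mulr_natr polyr_half.
Qed.

Lemma fps_cst_half (R : comNzRingType) (c : R) : c *+ 2 = 1 -> 2%:R * fcst c = 1 :> fps R.
Proof. by move=> c2; rewrite mulr_natl -rmorphMn -polyCMn c2. Qed.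

Lemma WHfactor_sqr :
  2%:R * (WHfactor * WHfactor) = 1 - 8%:R * Tv * (1 + xP) + PsqrtX.
Proof. by rewrite WHfactorP.2 mulrA (fps_cst_half polyr_half) mul1r. Qed.

Lemma size_WHfactor n : (size (WHfactor n) <= n.+1)%N.
Proof.
apply: (sqrt_degree _ WHfactorP.1 WHfactorP.2) => // {}n.
rewrite fpsCM size_Cmul // fpsDn.
have s1 : (size (PsqrtX n) <= n.+1)%N.
  rewrite /PsqrtX /fps_map_scale (leq_trans (size_polyMleq _ _)) //.
  by rewrite size_polyXn addnS /= -add1n leq_add2r size_polyC; case: eqP.
have s2 : (size ((1 - 8%:R * Tv * (1 + xP))%R n) <= n.+1)%N.
  have -> : 1 - 8%:R * Tv * (1 + xP) = fcst 1 - Tv * fcst (8%:R * (1 + 'X : QX)).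
    by rewrite !(rmorph1, rmorph_nat, rmorphM, rmorphD) /=; ring.
  case: n {s1} => [|n].
    by rewrite fpsBn fpsXM0 subr0 fps_of_polyCn size_poly1.
  rewrite fpsBn fpsXS !fps_of_polyCn sub0r size_polyN.
  case: ifP => _; last by rewrite size_poly0.
  rewrite -polyC_natr mul_polyC (leq_trans (size_scale_leq _ _)) //.
  rewrite (leq_trans (size_polyD _ _)) // geq_max size_poly1 size_polyX; lia.
by rewrite (leq_trans (size_polyD _ _)) // geq_max s1 s2.
Qed.

(** The expansion of (1 - 4 T (1+X)^2)^(-1/2): coefficient n counts unrestricted walks of length 2n
    that end on y = 0, by their steps to the right. *)
Definition Wbin : fps QX := fun n => ((1 + 'X) ^+ n.*2) *+ 'C(n.*2, n).

Lemma Wbin_sqr : Wbin * Wbin * (1 - 4%:R * Tv * (1 + xP) ^+ 2) = 1.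
Proof.
have -> : Wbin = fps_map_scale (@polyC rat) (4%:R%:P * (1 + 'X) ^+ 2) (binser 2%:R^-1).
  apply: fpsP => n; rewrite /Wbin /fps_map_scale exprMn -exprM mulrA mul2n.
  rewrite -polyC_exp -polyCM [_ * 4%:R ^+ n]mulrC central_binomialE.
  by rewrite polyC_natr mulr_natl.
rewrite -rmorphM binserD.
have -> : 1 - 4%:R * Tv * (1 + xP) ^+ 2 =
    fps_map_scale (@polyC rat) (4%:R%:P * (1 + 'X) ^+ 2) (1 - Tv).
  rewrite rmorphB rmorph1 /= fps_map_scaleX; congr (1 - _).
  rewrite polyC_natr.
  by rewrite !(rmorph1, rmorph_nat, rmorphM, rmorphXn, rmorphD) /=; ring.
by rewrite -rmorphM (_ : 2^-1 + 2^-1 = 1 :> rat) // binser1_inv rmorph1.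
Qed.

(** Coefficient n of the product is X^n h(n), so for positive n it is divisible by X^(n+1). The
    square of the product is a / (a - 8 X^2 T) with a = 1 - 8 X T + sqrt (1 - 16 X T), a series in X
    T whose coefficients are polynomials in X. *)
Lemma WHfactor_positive : exists h : fps QX,
  [/\ h 0%N = 1, (forall n, (h n.+1).[0] = 0) &
      WHfactor * Wbin = fps_map_scale (@idfun QX) 'X h].
Proof.
pose r : fps QX := fps_map_scale (@polyC rat) 1 Psqrt.
have r0 : r 0%N = 1 by rewrite /r fps_map_scale0 PsqrtP.1.
pose d : fps QX := fcst (2%:R^-1 : rat)%:P * (1 - 8%:R * Tv + r).
have dE : 2%:R * d = 1 - 8%:R * Tv + r.
  by rewrite /d mulrA (fps_cst_half polyr_half) mul1r.
have d0 : d 0%N = 1.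
  rewrite /d fpsCM !(fpsDn, fpsNn) !fpsMn0 fps_of_polyX0 fps1n mulr0 subr0 r0.
  by rewrite -mulr2n mulr_natr polyr_half.
(* Under T := X T the series d and e become a / 2 and (a - 8 X^2 T) / 2, so h is built as the root
   of d / e. *)
clearbody d; pose e := d - 4%:R * xP * Tv.
have e0 : e 0%N = 1 by rewrite /e fpsBn d0 !fpsMn0 fps_of_polyX0 mulr0 subr0.
have [i [i0 ei]] := fps_inv_exists e0.
have [h [h0 hh]] : exists h : fps QX, h 0%N = 1 /\ h * h = d * i.
  by apply: (fps_sqrt_exists polyr_half); rewrite fpsMn0 d0 i0 mulr1.
have hhe : h * h * e = d by rewrite hh -mulrA [i * e]mulrC ei mulr1.
exists h; split=> //.
  (* At X = 0 the series d and e coincide, hence h squares to 1 there and is 1. *)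
  pose ev : fps QX -> fps rat := fps_map_scale (@horner_eval rat 0) 1.
  have evh : ev h * ev h = 1 * 1.
    have evd0 : ev d 0%N != 0 by rewrite /ev fps_map_scale0 d0 /= /horner_eval hornerC oner_eq0.
    have evM f g : ev (f * g) = ev f * ev g by rewrite /ev rmorphM.
    have evde : ev d = ev e.
      rewrite /e /ev rmorphB rmorphM /= [X in _ - X * _]rmorphM /= fps_map_scaleC.
      by rewrite /= /horner_eval hornerX polyC0 rmorph0 mulr0 mul0r subr0.
    by apply: (fps_mulIf evd0); rewrite !mul1r {1}evde -!evM hhe.
  have ev0 : ev h 0%N = 1 by rewrite /ev fps_map_scale0 h0 /= /horner_eval hornerC.
  have := fps_sqr_inj _ ev0 _ evh => /(_ isT); rewrite fps1n => /(_ erefl) evh1 n.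
  have := congr1 (fun f : fps rat => f n.+1) evh1.
  by rewrite /= /ev /fps_map_scale expr1n mulr1 fps1n.
pose s : fps QX -> fps QX := fps_map_scale (@idfun QX) 'X.
have sr : s r = PsqrtX.
  by apply: fpsP => n; rewrite /s /PsqrtX /fps_map_scale /= /r /fps_map_scale expr1n mulr1.
have she : s h * s h * (1 - 8%:R * xP * Tv + PsqrtX - 8%:R * xP ^+ 2 * Tv) =
    1 - 8%:R * xP * Tv + PsqrtX.
  have sM f g : s (f * g) = s f * s g by rewrite /s rmorphM.
  have sD f g : s (f + g) = s f + s g by rewrite /s rmorphD.
  have sN f : s (- f) = - s f by rewrite /s rmorphN.
  have sn k : s k%:R = k%:R by rewrite /s rmorph_nat.
  have s1 : s 1 = 1 by rewrite /s rmorph1.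
  have sX : s Tv = xP * Tv by rewrite /s fps_map_scaleX.
  have sx : s xP = xP by rewrite /s fps_map_scaleC.
  have := congr1 (fun f => s (2%:R * f)) hhe.
  have -> : 2%:R * (h * h * e) = h * h * (1 - 8%:R * Tv + r - 8%:R * xP * Tv).
    by rewrite -dE /e; ring.
  rewrite dE !(s1, sn, sM, sD, sN) sX sx sr => E.
  by rewrite -[8%:R * xP * Tv]mulrA -[RHS]E; congr (_ * _); ring.
have sh0 : s h 0%N = 1 by rewrite /s fps_map_scale0.
apply: fps_sqr_inj => //; first exact: poly2_neq0.
  by rewrite fpsMn0 WHfactorP.1 /Wbin bin0 expr0 mul1r.
rewrite -/s; set a := 1 - 8%:R * xP * Tv + PsqrtX in she.
have a0 : a 0%N = 2%:R.
  by rewrite /a !(fpsDn, fpsNn) !fpsMn0 fps_of_polyX0 fps1n mulr0 subr0 PsqrtX0.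
have a20 : (2%:R * (a - 8%:R * xP ^+ 2 * Tv)) 0%N != 0 :> QX.
  rewrite fpsMn0 fpsBn !fpsMn0 fps_of_polyX0 mulr0 subr0 a0 fps_natr0.
  by rewrite mulf_neq0 // poly2_neq0.
apply: (fps_mulIf a20).
(* The kernel factorisation: up to the factor 2 a, the kernel 1 - 4 T (1+X)^2 splits into 2 q^2 = a
   - 8 T and the denominator a - 8 X^2 T. Expanded, it says (a - 1 + 8 X T)^2 = 1 - 16 X T. *)
have key : (a - 8%:R * Tv) * (a - 8%:R * xP ^+ 2 * Tv) =
    2%:R * a * (1 - 4%:R * Tv * (1 + xP) ^+ 2).
  apply/eqP; rewrite -subr_eq0; apply/eqP.
  transitivity (PsqrtX * PsqrtX - (1 - 16%:R * xP * Tv)); first by rewrite /a; ring.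
  by rewrite PsqrtX_sqr subrr.
transitivity (Wbin * Wbin * ((2%:R * (WHfactor * WHfactor)) * (a - 8%:R * xP ^+ 2 * Tv))).
  by ring.
rewrite WHfactor_sqr.
have -> : 1 - 8%:R * Tv * (1 + xP) + PsqrtX = a - 8%:R * Tv by rewrite /a; ring.
rewrite key.
transitivity (2%:R * a * (Wbin * Wbin * (1 - 4%:R * Tv * (1 + xP) ^+ 2))); first by ring.
rewrite Wbin_sqr mulr1 -[in LHS]she; ring.
Qed.

(** * Counting walks by their numbers of positive steps *)

Section SnocFfun.
Variables (E : finType) (n : nat).

Definition ffun_snoc (s : {ffun 'I_n -> E}) (e : E) : {ffun 'I_n.+1 -> E} :=
  [ffun i => if unlift ord_max i is Some j then s j else e].

Lemma ffun_snoc_widen s e (i : 'I_n) : ffun_snoc s e (widen_ord (leqnSn n) i) = s i.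
Proof.
have -> : widen_ord (leqnSn n) i = lift ord_max i.
  by apply: val_inj; rewrite /= /bump leqNgt ltn_ord.
by rewrite ffunE liftK.
Qed.

Lemma ffun_snoc_max s e : ffun_snoc s e ord_max = e.
Proof. by rewrite ffunE unlift_none. Qed.

Lemma big_ffun_snoc (V : nmodType) (F : {ffun 'I_n.+1 -> E} -> V) :
  \sum_s F s = \sum_s \sum_e F (ffun_snoc s e).
Proof.
rewrite pair_big /=.
rewrite (reindex (fun p : {ffun 'I_n -> E} * E => ffun_snoc p.1 p.2)) //=.
exists (fun s => ([ffun i => s (widen_ord (leqnSn n) i)], s ord_max)) => [[s e] _|s _] /=.
  by rewrite ffun_snoc_max; congr (_, _); apply/ffunP => i; rewrite ffunE ffun_snoc_widen.
apply/ffunP => i; rewrite ffunE; case: unliftP => [j ->|->//].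
rewrite ffunE; congr (s _).
by apply: val_inj; rewrite /= /bump leqNgt ltn_ord.
Qed.

End SnocFfun.

Local Notation step := (bool * bool)%type.

Definition nplus (p : pred step) n (s : {ffun 'I_n -> step}) : nat :=
  \sum_(k < n) p (s k).

Lemma nplus_snoc p n (s : {ffun 'I_n -> step}) e :
  nplus p (ffun_snoc s e) = (nplus p s + p e)%N.
Proof.
rewrite /nplus big_ord_recr /= ffun_snoc_max; congr (_ + _)%N.
by apply: eq_bigr => i _; rewrite ffun_snoc_widen.
Qed.

Lemma nplus_le p n (s : {ffun 'I_n -> step}) : (nplus p s <= n)%N.
Proof.
rewrite -[X in (_ <= X)%N]card_ord -sum1_card.
by apply: leq_sum => i _; case: (p _).
Qed.

Lemma pos_end n (s : {ffun 'I_n -> step}) :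
  pos s n = ((nplus fst s).*2%:Z - n%:Z, (nplus snd s).*2%:Z - n%:Z).
Proof.
have H (p : pred step) (d : step -> int) : (forall e, d e = if p e then 1 else -1) ->
    \sum_(k < n | (k < n)%N) d (s k) = (nplus p s).*2%:Z - n%:Z.
  move=> dE; rewrite /nplus (eq_bigl xpredT) => [|k]; last by rewrite ltn_ord.
  rewrite -[in X in _ - X](card_ord n) -sum1_card -mul2n PoszM.
  rewrite !(big_morph Posz PoszD (erefl _)) mulr_sumr -sumrB.
  by apply: eq_bigr => k _; rewrite dE; case: (p _).
by rewrite /pos; congr (_, _); exact: H.
Qed.

Lemma pos_snoc n (s : {ffun 'I_n -> step}) e m : (m <= n)%N ->
  pos (ffun_snoc s e) m = pos s m.
Proof.
move=> mn; rewrite /pos; congr (_, _); rewrite big_mkcond big_ord_recr /=;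
  rewrite [(n < m)%N]ltnNge mn addr0 [RHS]big_mkcond;
  by apply: eq_bigr => i _; rewrite ffun_snoc_widen.
Qed.

Lemma slit_snoc n (s : {ffun 'I_n -> step}) e :
  slit (ffun_snoc s e) = slit s && ~~ inH (pos (ffun_snoc s e) n.+1).
Proof.
apply/forallP/andP => [H|[/forallP H Hn] m].
  split; last exact: (H ord_max).
  apply/forallP => m; have := H (widen_ord (leqnSn n) m).
  by rewrite /= pos_snoc // ltn_ord.
case: (unliftP ord_max m) => [j ->|->//].
by rewrite lift_max pos_snoc ?ltn_ord.
Qed.

Definition slit_bad n a b := inH (a.*2%:Z - n%:Z, b.*2%:Z - n%:Z).

(** The inner variable is X and the outer one is Y. Counting positive steps instead of coordinates
    avoids Laurent polynomials. *)
Definition mono a b : {poly QX} := ('X^a)%:P * 'X^b.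

Lemma coef_mono a b i j : (mono a b)`_j`_i = ((i == a) && (j == b))%:R.
Proof.
rewrite /mono coefCM coefXn; case: (j == b); last by rewrite mulr0 coef0 andbF.
by rewrite mulr1 coefXn andbT.
Qed.

Lemma monoM a b i j : mono a b * mono i j = mono (a + i) (b + j).
Proof. by rewrite /mono !exprD polyCM; ring. Qed.

Definition Walks : fps {poly QX} := fun n =>
  \sum_(s : {ffun 'I_n -> step} | slit s) mono (nplus fst s) (nplus snd s).

Local Notation stepP := ((1 + 'X%:P) * (1 + 'X) : {poly QX}).

Lemma stepPE : stepP = \sum_(e : step) mono (fst e) (snd e).
Proof.
rewrite -(pair_bigA _ (fun a b : bool => mono a b)) /= !big_bool /= /mono.
by rewrite !expr0 !expr1; ring.
Qed.

Lemma Walks0 : Walks 0%N = 1.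
Proof.
rewrite /Walks (bigD1 [ffun=> (true, true)]) /=; last by apply/forallP => -[].
rewrite big1 => [|s /andP[_ /eqP[]]]; last by apply/ffunP => -[].
by rewrite /nplus !big_ord0 /mono !expr0 addr0 mulr1.
Qed.

(** Remove the last step: the prefix is an arbitrary slit walk, and the only new condition is that
    the endpoint avoid the half-line. *)
Lemma coef_WalksS n a b : (Walks n.+1)`_b`_a =
  if slit_bad n.+1 a b then 0 else (stepP * Walks n)`_b`_a.
Proof.
have bigcoef (I : finType) (f : I -> {poly QX}) :
    (\sum_i f i)`_b`_a = \sum_i (f i)`_b`_a by rewrite !coef_sum.
have -> : stepP * Walks n = \sum_(s : {ffun 'I_n -> step}) \sum_e
    (if slit s then mono (nplus fst (ffun_snoc s e)) (nplus snd (ffun_snoc s e)) else 0).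
  rewrite stepPE mulrC /Walks big_mkcond mulr_suml; apply: eq_bigr => s _.
  rewrite mulr_sumr; apply: eq_bigr => e _; case: ifP => _; last by rewrite mul0r.
  by rewrite monoM !nplus_snoc.
rewrite /Walks big_mkcond big_ffun_snoc !bigcoef.
transitivity (\sum_(s : {ffun 'I_n -> step}) if slit_bad n.+1 a b then 0 else
   (\sum_e if slit s then mono (nplus fst (ffun_snoc s e)) (nplus snd (ffun_snoc s e))
     else 0)`_b`_a); last by case: ifP => _ //; rewrite big1.
apply: eq_bigr => s _; rewrite !bigcoef.
transitivity (\sum_e if slit_bad n.+1 a b then 0 else
   (if slit s then mono (nplus fst (ffun_snoc s e)) (nplus snd (ffun_snoc s e))
     else 0)`_b`_a); last by case: ifP => _ //; rewrite big1.
apply: eq_bigr => e _; rewrite slit_snoc pos_end.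
case: (slit s) => /=; last by rewrite !coef0 if_same.
set i := nplus _ _; set j := nplus _ _.
rewrite -[inH _]/(slit_bad n.+1 i j).
have [ai|ai] := eqVneq a i; have [bj|bj] := eqVneq b j; rewrite -?ai -?bj;
  case: (slit_bad _ _ _); case: (slit_bad _ _ _);
  by rewrite /= ?coef0 ?coef_mono ?(negPf ai) ?(negPf bj) ?andbF.
Qed.

(** After exchanging sums, each walk meets exactly one cell of the grid, indexed by its doubled step
    counts. The weight F is arbitrary so that this serves both S(x,y;t) and a(n). *)
Lemma sum_acount (V : comNzRingType) (F : int -> int -> V) n :
  \sum_(k < (2 * n).+1) \sum_(l < (2 * n).+1)
     (acount n (k%:Z - n%:Z) (l%:Z - n%:Z))%:R * F (k%:Z - n%:Z) (l%:Z - n%:Z)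
  = \sum_(s : {ffun 'I_n -> step} | slit s)
      F ((nplus fst s).*2%:Z - n%:Z) ((nplus snd s).*2%:Z - n%:Z).
Proof.
transitivity (\sum_(k < (2 * n).+1) \sum_(l < (2 * n).+1)
    \sum_(s : {ffun 'I_n -> step} | slit s)
   (if (k == (nplus fst s).*2 :> nat) && (l == (nplus snd s).*2 :> nat)
    then F (k%:Z - n%:Z) (l%:Z - n%:Z) else 0)).
  apply: eq_bigr => k _; apply: eq_bigr => l _.
  rewrite /acount -sum1_card natr_sum mulr_suml big_mkcond [RHS]big_mkcond.
  apply: eq_bigr => s _; rewrite inE pos_end xpair_eqE.
  rewrite !(inj_eq (addIr _)) !eqz_nat ![_.*2 == _]eq_sym.
  by case: (slit s) => //=; case: ifP; rewrite ?mul1r ?mul0r.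
under eq_bigr do rewrite exchange_big /=.
rewrite exchange_big /=; apply: eq_bigr => s _.
have lt p : ((nplus p s).*2 < (2 * n).+1)%N.
  by have := nplus_le p s; rewrite ltnS mul2n leq_double.
rewrite (bigD1 (Ordinal (lt fst))) //= (bigD1 (Ordinal (lt snd))) //= !eqxx /=.
rewrite [X in _ + X + _]big1 => [|l /eqP H]; last first.
  by case: eqP => // E; case: H; apply: val_inj.
rewrite [X in _ + X]big1 ?addr0 // => k /eqP H.
by rewrite big1 // => l _; case: eqP => // E; case: H; apply: val_inj.
Qed.

(** * The candidate series and its kernel recurrence *)

Definition fps_geom (R : comNzRingType) (c : R) : fps R := fun n => c ^+ n.

Lemma fps_geomE (R : comNzRingType) (c : R) :
  fps_geom c * (1 - fps_of_poly c%:P * fps_of_poly 'X) = 1.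
Proof.
apply: fpsP => -[|n]; rewrite mulrBr mulr1 fpsBn mulrCA mulrC -mulrA mulrCA.
  by rewrite fpsXM0 subr0 fps1n.
by rewrite fpsXS mulrC fpsCM /fps_geom -exprS subrr fps1n.
Qed.

Lemma coef_1DX_exp (R : comNzRingType) n i :
  ((1 + 'X : {poly R}) ^+ n)`_i = 'C(n, i)%:R.
Proof.
elim: n i => [|n IHn] [|i]; rewrite ?expr0 ?coef1 //.
  by rewrite exprS mulrDl mul1r coefD coefXM IHn addr0 !bin0.
by rewrite exprS mulrDl mul1r coefD coefXM !IHn /= binS natrD.
Qed.

(** The substitution T := Y t^2 places the terms of q at Y^p t^(2p), that is, on the line y = 0. *)
Definition WHsource : fps {poly QX} :=
  fps_sqvar (fps_map_scale (@polyC QX) 'X WHfactor).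

Definition slit_series : fps {poly QX} := WHsource * fps_geom stepP.

Lemma slit_series_kernel :
  slit_series * (1 - fps_of_poly stepP%:P * fps_of_poly 'X) = WHsource.
Proof. by rewrite /slit_series -mulrA fps_geomE mulr1. Qed.

Lemma slit_seriesS n :
  slit_series n.+1 = stepP * slit_series n + WHsource n.+1.
Proof.
rewrite -slit_series_kernel mulrBr mulr1 fpsBn mulrCA [slit_series * _]mulrC.
by rewrite fpsCM fpsXS addrC subrK.
Qed.

(** Source term k already carries Y^k; the missing Y^(p-k) is the middle coefficient of
    (1+Y)^(2(p-k)), a central binomial coefficient. *)
Lemma coef_slit_series_diag p : (slit_series p.*2)`_p = (WHfactor * Wbin) p.
Proof.
rewrite /slit_series fpsMn.
rewrite (@sum_ord_even _ (fun k => WHsource k * fps_geom stepP (p.*2 - k)%N)); last first.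
  by move=> k ok; rewrite /WHsource /fps_sqvar ok mul0r.
rewrite doubleK coef_sum fpsMn; apply: eq_bigr => k _.
rewrite /WHsource fps_sqvar_double /fps_map_scale -doubleB /fps_geom exprMn.
have kp : (k <= p)%N by rewrite -ltnS.
rewrite -mulrA coefCM mulrCA -(rmorph1 (@polyC QX)) -rmorphD -rmorphXn /= coefCM.
rewrite coefXnM ltnNge kp /= polyC1 coef_1DX_exp /Wbin.
by rewrite mulr_natr.
Qed.

Lemma slit_series_bad n a b : slit_bad n.+1 a b -> (slit_series n.+1)`_b`_a = 0.
Proof.
rewrite /slit_bad /inH /= => /andP[/eqP bn an].
have [h [_ h0 hE]] := WHfactor_positive.
have nb : n.+1 = b.*2 by lia.
rewrite nb coef_slit_series_diag hE /fps_map_scale /= coefMXn.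
have ab : (a <= b)%N by lia.
rewrite ltnNge; case: (leqP b a) => //= ba.
have -> : (a - b = 0)%N by lia.
by case: b {an bn ab ba} nb => // b _; rewrite -horner_coef0 h0.
Qed.

(** The degree bound a <= b on the terms at Y^b t^(2b) is exactly the condition that the abscissa 2a
    - 2b be nonpositive. *)
Lemma WHsource_good n a b : ~~ slit_bad n a b -> (WHsource n)`_b`_a = 0.
Proof.
rewrite /WHsource /fps_sqvar; case: (boolP (odd n)) => [|en]; first by rewrite !coef0.
rewrite /fps_map_scale coefCM coefXn; case: eqP => [->|_]; last by rewrite mulr0 coef0.
rewrite mulr1 /slit_bad /inH /= => ng.
apply: nth_default; apply: leq_trans (size_WHfactor _) _.
by have := even_halfK en; lia.
Qed.

(* Both sides satisfy the recurrence of [coef_WalksS]: off the half-line the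
   source term vanishes, and on it the series does. *)
Lemma Walks_closed_form : Walks = slit_series.
Proof.
apply: fpsP; elim=> [|n IHn].
  rewrite Walks0 /slit_series fpsMn0 /WHsource /fps_sqvar /= fps_map_scale0.
  by rewrite WHfactorP.1 rmorph1 mul1r.
apply/polyP => b; apply/polyP => a; rewrite coef_WalksS IHn.
case: (boolP (slit_bad _ _ _)) => [/slit_series_bad -> //|/WHsource_good H].
by rewrite slit_seriesS !coefD H addr0.
Qed.

(** * Algebraic degree *)

Section AlgebraicDegree.
Variable F : fieldType.

(** Not being a square in F(t), with denominators cleared. *)
Definition nonsquare (f : {poly F}) := forall a b, f * (a * a) = b * b -> a = 0.

(** Descent at the simple root c: X - c divides b, hence a, and the quotients satisfy the same
    equation with a of smaller degree. *)
Lemma simple_root_nonsquare (c : F) (g : {poly F}) :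
  g.[c] != 0 -> nonsquare (('X - c%:P) * g).
Proof.
move=> gc a; move: {2}(size a) (leqnn (size a)) => n.
elim: n a => [|n IHn] a an b ab; first by apply/eqP; rewrite -size_poly_leq0.
have /factor_theorem [b' bE] : root b c.
  rewrite /root; have /eqP := congr1 (fun p : {poly F} => p.[c]) ab.
  by rewrite !hornerM hornerXsubC subrr !mul0r eq_sym mulf_eq0 orbb.
have Xc0 : 'X - c%:P != 0 by rewrite polyXsubC_eq0.
have ab' : g * (a * a) = ('X - c%:P) * (b' * b').
  apply: (mulfI Xc0); transitivity (b * b); first by rewrite -ab; ring.
  by rewrite bE; ring.
have /factor_theorem [a' aE] : root a c.
  rewrite /root; have /eqP := congr1 (fun p : {poly F} => p.[c]) ab'.
  by rewrite !hornerM hornerXsubC subrr mul0r mulf_eq0 (negPf gc) mulf_eq0 orbb.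
suff a'0 : a' = 0 by rewrite aE a'0 mul0r.
have [a'0|a'0] := eqVneq a' 0; first by [].
apply: (IHn _ _ b').
  by move: an; rewrite aE size_Mmonic ?monicXsubC // size_XsubC addn2.
apply: (mulfI Xc0); rewrite -ab' aE; ring.
Qed.

Variables (al rho kap : {poly F}) (S q r : fps F).
Hypothesis two0 : 2%:R != 0 :> F.
Hypothesis rho_nonsq : nonsquare rho.
Hypothesis norm_nonsq : nonsquare (al * al - rho).
Hypothesis kap0 : kap != 0.
Local Notation phi := (@fps_of_poly F).
Hypothesis rr : r * r = phi rho.
Hypothesis qq : 2%:R * (q * q) = phi al + r.
Hypothesis Skap : S * phi kap = q.

Lemma poly_two0 : 2%:R != 0 :> {poly F}.
Proof. by rewrite -polyC_natr polyC_eq0. Qed.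

(** Since 2 q^2 - al = r squares to rho and q = kap S, the series S is a root of (2 kap^2 Z^2 -
    al)^2 - rho. *)
Lemma annihilator_exists :
  exists P : {poly {poly F}}, size P = 5%N /\ fps_eval P S = fps_zero F.
Proof.
pose A : {poly {poly F}} := (2%:R * kap ^+ 2)%:P * 'X^2 - al%:P.
have k20 : 2%:R * kap ^+ 2 != 0 by rewrite mulf_neq0 ?poly_two0 // expf_neq0.
have sA : size A = 3%N.
  rewrite /A size_polyDl; first by rewrite size_Cmul // size_polyXn.
  by rewrite size_Cmul // size_polyXn size_polyN (leq_ltn_trans (size_polyC_leq1 _)).
have sA2 : size (A ^+ 2) = 5%N.
  have A0 : A != 0 by rewrite -size_poly_gt0 sA.
  have := size_exp A 2; rewrite sA; have : (0 < size (A ^+ 2))%N.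
    by rewrite size_poly_gt0 expf_neq0.
  by case: size => //= m _ ->.
exists (A ^+ 2 - rho%:P); split.
  by rewrite size_polyDl sA2 // size_polyN (leq_ltn_trans (size_polyC_leq1 _)).
rewrite fps_evalE -[RHS]/(0 : fps F).
rewrite rmorphB rmorphXn /A rmorphB rmorphM /= !map_polyC map_polyXn /=.
rewrite hornerD hornerN horner_exp hornerD hornerN hornerM !hornerC hornerXn.
have -> : phi (2%:R * kap ^+ 2) * S ^+ 2 = 2%:R * (q * q).
  by rewrite rmorphM rmorph_nat rmorphXn /= -Skap; ring.
by rewrite qq [phi al + r]addrC addrK expr2 rr subrr.
Qed.

Lemma root_combination a b : phi a + phi b * r = 0 -> a = 0 /\ b = 0.
Proof.
move=> E; have b0 : b = 0.
  apply: (rho_nonsq (b := a)); apply: fps_of_poly_inj; rewrite !rmorphM /= -rr.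
  have -> : phi a = - (phi b * r) by apply/eqP; rewrite -addr_eq0 E.
  by ring.
split=> //; apply: fps_of_poly_inj; rewrite rmorph0.
by move: E; rewrite b0 rmorph0 mul0r addr0.
Qed.

(** Linear independence of 1, r, q, r q. Isolate the q-part, square it with 2 q^2 = al + r, and
    compare the components along 1 and r. *)
Lemma radical_combination a b c d :
  phi a + phi b * r + (phi c + phi d * r) * q = 0 -> [/\ a = 0, b = 0, c = 0 & d = 0].
Proof.
move=> E.
have E2 : phi (2%:R * (a * a + b * b * rho)
     - ((c * c + d * d * rho) * al + 2%:R * c * d * rho))
   + phi (4%:R * a * b - (c * c + d * d * rho + 2%:R * c * d * al)) * r = 0.
  have EA : phi a + phi b * r = - ((phi c + phi d * r) * q).
    by apply/eqP; rewrite -addr_eq0 E.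
  rewrite !(rmorph_nat, rmorphM, rmorphB, rmorphD) /= -rr.
  transitivity (2%:R * ((phi a + phi b * r) * (phi a + phi b * r))
     - (phi c + phi d * r) * (phi c + phi d * r) * (phi al + r)); first by ring.
  by rewrite EA -qq; ring.
have [/eqP] := root_combination E2; rewrite subr_eq0 => /eqP EU /eqP.
rewrite subr_eq0 => /eqP EV.
(* This is the norm, from F(t)(r) to F(t), of 2 (a + b r)^2 = (c + d r)^2 (al + r). *)
have N : (al * al - rho) * ((c * c - rho * (d * d)) * (c * c - rho * (d * d)))
   = (2%:R * (a * a - rho * (b * b))) * (2%:R * (a * a - rho * (b * b))).
  transitivity (((c * c + d * d * rho) * al + 2%:R * c * d * rho) ^+ 2
    - rho * (c * c + d * d * rho + 2%:R * c * d * al) ^+ 2); first by ring.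
  by rewrite -EU -EV; ring.
have /eqP := norm_nonsq N; rewrite subr_eq0 => /eqP cd.
have d0 := rho_nonsq (esym cd).
have c0 : c = 0.
  by move: cd; rewrite d0 !mulr0 => /eqP; rewrite mulf_eq0 orbb => /eqP.
move: E; rewrite c0 d0 !rmorph0 mul0r addr0 mul0r addr0.
by case/root_combination.
Qed.

Lemma no_small_annihilator (P : {poly {poly F}}) :
  P != 0 -> (size P <= 4)%N -> fps_eval P S <> fps_zero F.
Proof.
move=> P0 sP; rewrite fps_evalE -[fps_zero F]/(0 : fps F) => E.
case/negP: P0; apply/eqP.
have {}E : phi P`_0 + phi P`_1 * S + phi P`_2 * S ^+ 2 + phi P`_3 * S ^+ 3 = 0.
  rewrite -E (@horner_coef_wide _ 4) ?(leq_trans (size_poly _ _)) //.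
  rewrite !big_ord_recr big_ord0 /= add0r expr0 mulr1 expr1.
  by rewrite !coef_map.
(* Multiply by 2 kap^3 to replace powers of S by powers of q, then reduce q^2 and q^3 to the basis
   1, r, q, r q. *)
have {}E : phi (2%:R * P`_0 * kap ^+ 3 + P`_2 * kap * al) + phi (P`_2 * kap) * r +
    (phi (2%:R * P`_1 * kap ^+ 2 + P`_3 * al) + phi P`_3 * r) * q = 0.
  rewrite !(rmorph_nat, rmorphM, rmorphXn, rmorphD) /=.
  transitivity (2%:R * phi kap ^+ 3 * (phi P`_0 + phi P`_1 * S + phi P`_2 * S ^+ 2
    + phi P`_3 * S ^+ 3)); last by rewrite E mulr0.
  transitivity (2%:R * phi P`_0 * phi kap ^+ 3 + phi P`_2 * phi kap * (phi al + r)
     + (2%:R * phi P`_1 * phi kap ^+ 2 + phi P`_3 * (phi al + r)) * q); first by ring.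
  by rewrite -qq -Skap; ring.
have [E0 E2 E1 E3] := radical_combination E.
have P2 : P`_2 = 0 by move/eqP: E2; rewrite mulf_eq0 (negPf kap0) orbF => /eqP.
have Pz : P`_0 = 0.
  apply: (mulfI (mulf_neq0 poly_two0 (expf_neq0 3 kap0))).
  by rewrite mulr0 -[RHS]E0 P2; ring.
have P1 : P`_1 = 0.
  apply: (mulfI (mulf_neq0 poly_two0 (expf_neq0 2 kap0))).
  by rewrite mulr0 -[RHS]E1 E3; ring.
apply/polyP => -[|[|[|[|k]]]]; rewrite coef0 //.
by rewrite nth_default // (leq_trans sP).
Qed.

End AlgebraicDegree.

(** * The closed forms *)

Lemma AserE :
  Aser = fps_map_scale (horner_eval (1 : rat) \o horner_eval (1 : QX)) 1 Walks.
Proof.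
apply: fpsP => n; rewrite /Aser /atotal natr_sum.
under eq_bigr do rewrite natr_sum; under eq_bigr do under eq_bigr do rewrite -[_%:R]mulr1.
rewrite (sum_acount (fun _ _ => 1)) /fps_map_scale /Walks rmorph_sum mulr_suml.
apply: eq_bigr => s _; rewrite expr1n mulr1 /mono /= /horner_eval.
by rewrite hornerM hornerC hornerXn expr1n mulr1 hornerXn expr1n.
Qed.

Lemma fps_of_polyZ (R : comNzRingType) (c : R) p :
  fps_of_poly (c *: p) = fcst c * fps_of_poly p.
Proof. by rewrite -mul_polyC rmorphM. Qed.

Lemma natr_fps (R : comNzRingType) n : fcst (n%:R : R) = n%:R.
Proof. by rewrite polyC_natr rmorph_nat. Qed.

(** * Closed form and degree after specialising X and Y to squares in a field *)

Section ClosedForm.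
Variables (F : fieldType) (ev : {rmorphism {poly QX} -> F}) (x y : F).
Hypotheses (x0 : x != 0) (y0 : y != 0).
Hypotheses (evX : ev 'X%:P = x ^+ 2) (evY : ev 'X = y ^+ 2).

Definition walk_gf : fps F := fun n =>
  \sum_(k < (2 * n).+1) \sum_(l < (2 * n).+1)
     (acount n (k%:Z - n%:Z) (l%:Z - n%:Z))%:R
       * x ^ (k%:Z - n%:Z) * y ^ (l%:Z - n%:Z).

Lemma exprz_double_sub (z : F) a n : z != 0 ->
  z ^ (a.*2%:Z - n%:Z) = (z ^+ 2) ^+ a * z^-1 ^+ n.
Proof.
move=> z0; rewrite expfzDr // -exprM mul2n; congr (_ * _).
by rewrite exprVn exprnN.
Qed.

(** A coordinate is 2a - n, and x^(2a-n) = (x^2)^a x^(-n): the factor (x y)^(-n) is absorbed by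
    rescaling t. *)
Lemma walk_gfE : walk_gf = fps_map_scale ev (x^-1 * y^-1) Walks.
Proof.
apply: fpsP => n; rewrite /walk_gf.
under eq_bigr do under eq_bigr do rewrite -mulrA.
rewrite (sum_acount (fun i j => x ^ i * y ^ j)) /fps_map_scale /Walks rmorph_sum mulr_suml.
apply: eq_bigr => s _.
rewrite !exprz_double_sub // /mono polyC_exp rmorphM !rmorphXn.
by rewrite /= evX evY [(_ / _) ^+ n]exprMn mulrACA.
Qed.

(* The substitution X := x^2, Tv := t^2 / x^2. *)
Definition toK (f : fps QX) : fps F :=
  fps_map_scale ev (x^-1 * y^-1) (fps_sqvar (fps_map_scale (@polyC QX) 'X f)).

Lemma toKM f g : toK (f * g) = toK f * toK g.
Proof. by rewrite /toK !rmorphM. Qed.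
Lemma toKD f g : toK (f + g) = toK f + toK g.
Proof. by rewrite /toK !rmorphD. Qed.
Lemma toKN f : toK (- f) = - toK f.
Proof. by rewrite /toK !rmorphN. Qed.
Lemma toKn n : toK n%:R = n%:R.
Proof. by rewrite /toK !rmorph_nat. Qed.
Lemma toK1 : toK 1 = 1.
Proof. by rewrite /toK !rmorph1. Qed.
Lemma toK_x : toK (fcst 'X) = fcst (x ^+ 2).
Proof. by rewrite /toK fps_map_scaleC fps_sqvarC fps_map_scaleC evX. Qed.
Lemma toK_T : toK Tv = fcst (x^-1 ^+ 2) * (Tv * Tv).
Proof.
have E : y ^+ 2 * (x^-1 * y^-1) ^+ 2 = x^-1 ^+ 2 by field; rewrite x0 y0.
rewrite -E /toK fps_map_scaleX rmorphM /= fps_sqvarC fps_sqvarX !rmorphM /=.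
rewrite fps_map_scaleC fps_map_scaleX evY.
by rewrite !(rmorphM, rmorphXn) /=; ring.
Qed.
Lemma toK0 f : toK f 0%N = ev ((f 0%N)%:P).
Proof. by rewrite /toK fps_map_scale0 /fps_sqvar /= fps_map_scale0. Qed.

Definition qK : fps F := toK WHfactor.
Definition rK : fps F := toK PsqrtX.

Lemma rK_sqr : rK * rK = 1 - 16%:R * (Tv * Tv).
Proof.
rewrite -toKM PsqrtX_sqr toKD toKN !toKM toK1 toKn toK_x toK_T.
congr (1 - _); rewrite mulrA -[_ * fcst _ * fcst _]mulrA -rmorphM -polyCM -exprMn.
by rewrite mulfV // expr1n mulr1.
Qed.

Lemma qK_sqr :
  2%:R * (qK * qK) = 1 - 8%:R * fcst (1 + x^-1 ^+ 2) * (Tv * Tv) + rK.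
Proof.
rewrite -toKM -(toKn 2) -toKM WHfactor_sqr toKD !(toKn, toK1, toKM, toKN, toKD).
rewrite toK_x toK_T; congr (_ - _ + _).
have -> : 1 + x^-1 ^+ 2 = x^-1 ^+ 2 * (1 + x ^+ 2).
  by rewrite mulrDr mulr1 -exprMn mulVf // expr1n addrC.
by rewrite !(rmorph1, rmorphM, rmorphXn, rmorphD) /=; ring.
Qed.

Lemma rK0 : rK 0%N = 1.
Proof. by rewrite /rK toK0 PsqrtX0 !rmorph1. Qed.

Lemma qK0 : qK 0%N = 1.
Proof. by rewrite /qK toK0 WHfactorP.1 !rmorph1. Qed.

Lemma walk_gf_kernel :
  walk_gf * (1 - fcst ((x + x^-1) * (y + y^-1)) * Tv) = qK.
Proof.
rewrite -[qK]/(fps_map_scale ev (x^-1 * y^-1) WHsource) -slit_series_kernel.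
rewrite -Walks_closed_form [RHS]rmorphM /= -walk_gfE; congr (_ * _).
rewrite [RHS]rmorphB [in RHS]rmorphM [in RHS]rmorph1 /= fps_map_scaleC fps_map_scaleX mulrA; congr (1 - _ * _).
rewrite -rmorphM -polyCM; have -> // : (x + x^-1) * (y + y^-1) =
   ev ((1 + 'X%:P) * (1 + 'X)) * (x^-1 * y^-1).
rewrite rmorphM !rmorphD rmorph1 evX evY.
by field; rewrite x0 y0.
Qed.

Hypothesis sqr_x1 : 1 + x ^+ 2 != 0.

(** F has characteristic zero because n + 1 is invertible in the domain of [ev]. *)
Lemma rat_natr_neq0 n : n.+1%:R != 0 :> F.
Proof.
apply/eqP => n0.
have : ev ((n.+1%:R%:P)%:P * ((n.+1%:R^-1)%:P)%:P) = 0.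
  by rewrite rmorphM !polyC_natr rmorph_nat n0 mul0r.
rewrite -!polyCM mulfV ?pnatr_eq0 // !rmorph1 => /eqP.
by rewrite oner_eq0.
Qed.

Let al : {poly F} := 1 - (8%:R * (1 + x^-1 ^+ 2)) *: 'X^2.
Let rho : {poly F} := 1 - 16%:R *: 'X^2.
Let kap : {poly F} := 1 - ((x + x^-1) * (y + y^-1)) *: 'X.

Lemma rho_nonsquare : nonsquare rho.
Proof.
have q4 : 4%:R * (4%:R^-1)%:P = 1 :> {poly F}.
  by rewrite -polyC_natr -polyCM mulfV ?rat_natr_neq0.
have -> : rho = ('X - (4%:R^-1)%:P) * (- (16%:R * 'X) - 4%:R).
  apply/eqP; rewrite -subr_eq0 /rho -mul_polyC polyC_natr.
  rewrite (_ : _ - _ = (1 - 4%:R * (4%:R^-1)%:P) * (1 + 4%:R * 'X)); first by rewrite q4 subrr mul0r.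
  by ring.
apply: simple_root_nonsquare.
rewrite -!polyC_natr hornerD !hornerN hornerM !hornerC hornerX.
have -> : - (16 * 4^-1) - 4 = - 8%:R :> F by field; rewrite rat_natr_neq0.
by rewrite oppr_eq0 rat_natr_neq0.
Qed.

(** With m = 1 + 1/x^2 the norm is 16 t^2 (2 m t - 1/x)(2 m t + 1/x), and c = 1/(2 m x) is a simple
    root; m is nonzero by [sqr_x1]. *)
Lemma norm_nonsquare : nonsquare (al * al - rho).
Proof.
pose m := 1 + x^-1 ^+ 2; pose c := x^-1 / (2%:R * m).
have m0 : m != 0.
  have -> : m = x^-1 ^+ 2 * (1 + x ^+ 2) by rewrite /m; field.
  by rewrite mulf_neq0 // expf_neq0 // invr_eq0.
have m20 : 2%:R * m != 0 by rewrite mulf_neq0 ?rat_natr_neq0.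
have mc : 2%:R * m * c = x^-1 by rewrite /c mulrC divfK.
have mcP : 2%:R * m%:P * c%:P = x^-1%:P :> {poly F}.
  by rewrite -polyC_natr -!polyCM mc.
have mP : m%:P = 1 + x^-1%:P * x^-1%:P :> {poly F} by rewrite /m expr2 polyCD polyCM.
have -> : al * al - rho =
    ('X - c%:P) * (16%:R * 'X^2 * (2%:R * m%:P) * (2%:R * m%:P * 'X + x^-1%:P)).
  transitivity (16%:R * 'X^2 * (2%:R * m%:P * 'X - 2%:R * m%:P * c%:P) *
     (2%:R * m%:P * 'X + x^-1%:P)); last by ring.
  by rewrite mcP /al /rho -/m -!mul_polyC polyCM !polyC_natr mP; ring.
apply: simple_root_nonsquare.
rewrite -!polyC_natr !(hornerM, hornerD, hornerC, hornerX, hornerXn) mc.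
have c0 : c != 0 by rewrite /c mulf_neq0 ?invr_eq0.
have x20 : x^-1 + x^-1 != 0 by rewrite -mulr2n -mulr_natl mulf_neq0 ?rat_natr_neq0 ?invr_eq0.
by rewrite mulf_neq0 // mulf_neq0 // mulf_neq0 ?rat_natr_neq0 // mulf_neq0.
Qed.

Lemma walk_gf_closed_form : exists r q : fps F,
  r 0%N = 1 /\ fps_mul r r = fps_of_poly rho /\ q 0%N = 1 /\
  fps_mul q q = fps_scale 2^-1 (fps_add (fps_of_poly al) r) /\
  fps_mul walk_gf (fps_of_poly kap) = q.
Proof.
have two : (2%:R^-1 : F) *+ 2 = 1 by rewrite -(mulr_natr 2%:R^-1 2) mulVf ?rat_natr_neq0.
exists rK, qK; split; first exact: rK0.
split.
  rewrite /rho rmorphB rmorph1 /= fps_of_polyZ rmorphXn natr_fps expr2; exact: rK_sqr.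
split; first exact: qK0.
split; last by rewrite /kap rmorphB rmorph1 /= fps_of_polyZ; exact: walk_gf_kernel.
rewrite fps_scaleE /al rmorphB rmorph1 /= fps_of_polyZ rmorphXn polyCM rmorphM /= natr_fps expr2.
transitivity (2%:R * fcst 2^-1 * (qK * qK)); first by rewrite (fps_cst_half two) mul1r.
transitivity (fcst 2^-1 * (2%:R * (qK * qK))); first by ring.
by rewrite qK_sqr.
Qed.

Lemma walk_gf_degree :
  (exists P : {poly {poly F}}, size P = 5%N /\ fps_eval P walk_gf = fps_zero F) /\
  (forall P : {poly {poly F}}, P != 0 -> (size P <= 4)%N ->
     fps_eval P walk_gf <> fps_zero F).
Proof.
have two := rat_natr_neq0 1.
have kap0 : kap != 0.
  apply/eqP => /(congr1 (fun p : {poly F} => p`_0)).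
  rewrite coefB coef1 coefZ coefX mulr0 subr0 coef0 => /eqP.
  by rewrite oner_eq0.
have rr : rK * rK = fps_of_poly rho.
  by rewrite rK_sqr /rho rmorphB rmorph1 /= fps_of_polyZ rmorphXn natr_fps expr2.
have qq : 2%:R * (qK * qK) = fps_of_poly al + rK.
  rewrite qK_sqr /al rmorphB rmorph1 /= fps_of_polyZ rmorphXn polyCM rmorphM /= natr_fps.
  by rewrite expr2.
have Sk : walk_gf * fps_of_poly kap = qK.
  by rewrite /kap rmorphB rmorph1 /= fps_of_polyZ walk_gf_kernel.
split; first exact: annihilator_exists two kap0 rr qq Sk.
exact: no_small_annihilator two rho_nonsquare norm_nonsquare kap0 rr qq Sk.
Qed.

End ClosedForm.

Definition evK : {rmorphism {poly QX} -> K} :=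
  @tofrac {poly QX} \o comp_poly ('X^2) \o map_poly (comp_poly ('X^2 : QX)).

Lemma evKX : evK 'X%:P = xK ^+ 2.
Proof.
by rewrite /evK /= map_polyC /= comp_polyC comp_polyX /xK -rmorphXn /= -polyC_exp.
Qed.

Lemma evKY : evK 'X = yK ^+ 2.
Proof. by rewrite /evK /= map_polyX comp_polyX /yK -rmorphXn. Qed.

Lemma xK_neq0 : xK != 0.
Proof. by rewrite /xK tofrac_eq0 polyC_eq0 polyX_eq0. Qed.

Lemma yK_neq0 : yK != 0.
Proof. by rewrite /yK tofrac_eq0 polyX_eq0. Qed.

Lemma sqr_xK1_neq0 : 1 + xK ^+ 2 != 0.
Proof.
rewrite /xK -rmorphXn -(rmorph1 (@tofrac {poly QX})) -rmorphD /= tofrac_eq0.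
rewrite -polyC_exp -polyC1 -polyCD polyC_eq0 -size_poly_gt0 addrC size_polyDl size_polyXn //.
by rewrite size_poly1.
Qed.

(** * Specialisation at x = y = 1 *)

Definition ev_one : {rmorphism QX -> rat} := horner_eval (1 : rat).

Definition qone : fps rat := fps_map_scale ev_one 1 WHfactor.

Lemma qone0 : qone 0%N = 1.
Proof. by rewrite /qone fps_map_scale0 WHfactorP.1 rmorph1. Qed.

Lemma qone_sqr : 2%:R * (qone * qone) = 1 - 16%:R * Tv + Psqrt.
Proof.
pose f : fps QX -> fps rat := fps_map_scale ev_one 1.
have fM a b : f (a * b) = f a * f b by rewrite /f rmorphM.
have fD a b : f (a + b) = f a + f b by rewrite /f rmorphD.
have fN a : f (- a) = - f a by rewrite /f rmorphN.
have fn n : f n%:R = n%:R by rewrite /f rmorph_nat.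
have f1 : f 1 = 1 by rewrite /f rmorph1.
have fT : f Tv = Tv by rewrite /f fps_map_scaleX rmorph1 mul1r.
have fx : f (fcst 'X) = 1.
  by rewrite /f fps_map_scaleC /ev_one /= /horner_eval hornerX rmorph1.
have fr : f PsqrtX = Psqrt.
  apply: fpsP => n; rewrite /f /PsqrtX /fps_map_scale expr1n mulr1 rmorphM rmorphXn.
  by rewrite /ev_one /= /horner_eval hornerC hornerX expr1n mulr1.
rewrite -fM -fn -fM WHfactor_sqr !(f1, fn, fM, fN, fD) fT fx fr; ring.
Qed.

Lemma Aser_kernel : Aser * (1 - 4%:R * Tv) = fps_sqvar qone.
Proof.
have -> : fps_sqvar qone =
    fps_map_scale (horner_eval (1 : rat) \o horner_eval (1 : QX)) 1 WHsource.
  apply: fpsP => n; rewrite /WHsource /qone /fps_sqvar {2}/fps_map_scale.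
  case: (odd n); first by rewrite rmorph0 mul0r.
  rewrite /fps_map_scale !expr1n !mulr1 /ev_one /= /horner_eval.
  by rewrite hornerM hornerC hornerXn expr1n mulr1.
rewrite -slit_series_kernel -Walks_closed_form AserE rmorphM /=; congr (_ * _).
rewrite rmorphB rmorph1 rmorphM /= fps_map_scaleX fps_map_scaleC rmorph1 mul1r.
rewrite /= /horner_eval !(hornerM, hornerD, hornerC, hornerX).
by rewrite -natr_fps; congr (1 - fcst _ * _).
Qed.

Lemma fps_pow4_inj (f g : fps rat) : f 0%N = 1 -> g 0%N = 1 ->
  f ^+ 4 = g ^+ 4 -> f = g.
Proof.
move=> f0 g0 fg; apply: fps_sqr_inj => //; apply: fps_sqr_inj => //.
- by rewrite fpsMn0 f0 mulr1.
- by rewrite fpsMn0 g0 mulr1.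
- by move: fg; rewrite !exprS expr0 !mulr1 !mulrA.
Qed.

Lemma fps_root4 (f : fps rat) : f 0%N = 1 -> exists g : fps rat, g 0%N = 1 /\ g ^+ 4 = f.
Proof.
move=> f0; have h : (2%:R^-1 : rat) *+ 2 = 1 by [].
have [g1 [g10 g1E]] := fps_sqrt_exists h f0.
have [g [g0 gE]] := fps_sqrt_exists h g10.
by exists g; split=> //; rewrite -g1E -gE; ring.
Qed.

Lemma Aser_closed_form : exists u v r w : fps rat,
      u 0%N = 1 /\ fps_pow u 4 = fps_of_poly (1 + 4%:R *: 'X) /\
      v 0%N = 1 /\ fps_pow v 4 = fps_of_poly ((1 - 4%:R *: 'X) ^+ 3) /\
      r 0%N = 1 /\ fps_mul r r = fps_of_poly (1 - 16%:R *: 'X^2) /\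
      w 0%N = 1 /\
      fps_mul w w = fps_scale 2^-1 (fps_add (fps_of_poly 1) r) /\
      fps_mul Aser v = fps_mul u w.
Proof.
have h : (2%:R^-1 : rat) *+ 2 = 1 by [].
pose a := 1 - 4%:R * Tv : fps rat; pose b := 1 + 4%:R * Tv : fps rat.
have a0 : a 0%N = 1 by rewrite /a fpsBn fpsMn0 fps_of_polyX0 mulr0 subr0 fps1n.
have b0 : b 0%N = 1 by rewrite /b fpsDn fpsMn0 fps_of_polyX0 mulr0 addr0 fps1n.
have [|u [u0 uE]] := @fps_root4 b; first by [].
have [|v [v0 vE]] := @fps_root4 (a ^+ 3); first by rewrite fpsXn0 a0 expr1n.
pose r := fps_sqvar Psqrt.
have r0 : r 0%N = 1 by rewrite /r /fps_sqvar /= PsqrtP.1.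
have rE : r * r = a * b.
  rewrite /r -rmorphM PsqrtP.2 rmorphB rmorph1 rmorphM rmorph_nat /= fps_sqvarX.
  by rewrite /a /b; ring.
have [|w [w0 wE]] := @fps_sqrt_exists _ _ (fcst (2%:R^-1) * (1 + r)) h.
  by rewrite fpsCM fpsDn r0 fps1n.
have wE2 : 2%:R * (w * w) = 1 + r by rewrite wE mulrA (fps_cst_half h) mul1r.
exists u, v, r, w; split=> //; split.
  by rewrite fps_powE uE rmorphD rmorph1 /= fps_of_polyZ natr_fps.
split=> //; split.
  by rewrite fps_powE vE rmorphXn rmorphB rmorph1 /= fps_of_polyZ natr_fps.
split=> //; split.
  rewrite -[LHS]/(r * r) rE rmorphB rmorph1 /= fps_of_polyZ rmorphXn natr_fps /a /b /=.
  by ring.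
split=> //; split.
  by rewrite fps_scaleE -[LHS]/(w * w) wE; congr (_ * (_ + _)); rewrite rmorph1.
rewrite -[LHS]/(Aser * v) -[RHS]/(u * w).
have AE : Aser * a = fps_sqvar qone by exact: Aser_kernel.
have q2 : 2%:R * (fps_sqvar qone * fps_sqvar qone) = r * r + r.
  rewrite -rmorphM -(rmorph_nat (@fps_sqvar rat)) -rmorphM /= qone_sqr rmorphD /=.
  by rewrite /r -rmorphM PsqrtP.2.
have A0 : Aser 0%N = 1.
  have := congr1 (fun f : fps rat => f 0%N) AE.
  by rewrite fpsMn0 a0 mulr1 /fps_sqvar /= qone0.
(* Fourth powers remove all radicals but r. Multiplied by 4 a^4, both sides equal a^4 b (1 + r)^2,
   by r^2 = a b and 2 (A a)^2 = r (1 + r) with A the series [Aser]. *)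
apply: fps_pow4_inj; rewrite ?fpsMn0 ?A0 ?v0 ?u0 ?w0 ?mulr1 //.
have c0 : (4%:R * a ^+ 4) 0%N != 0 :> rat by rewrite fpsMn0 fpsXn0 a0 fps_natr0.
apply: (fps_mulIf c0).
transitivity (v ^+ 4 * (2%:R * ((Aser * a) * (Aser * a))) ^+ 2); first by ring.
rewrite vE AE q2.
transitivity (u ^+ 4 * (2%:R * (w * w)) ^+ 2 * a ^+ 4); last by ring.
rewrite uE wE2.
transitivity (a ^+ 3 * (r * r) * (1 + r) ^+ 2); first by ring.
by rewrite rE; ring.
Qed.

(** * Asymptotics *)

Section NormalizedSeries.
Variable R : realType.
Local Notation b := (@binser R).

Lemma binser_neg1 : b (-1) = 1 - Tv.
Proof.
have b0 : b 1 0%N != 0 by rewrite binser0 oner_eq0.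
apply: (fps_mulIf b0).
rewrite [RHS]mulrC binser1_inv binserD addNr; apply: fpsP => n.
rewrite fps1n; case: n => [|n]; first by rewrite binser0.
by rewrite /binser big_ord_recl add0r mul0r mul0r.
Qed.

Lemma binserZ0 : b 0 = 1.
Proof.
apply: fpsP => n; rewrite fps1n; case: n => [|n]; first by rewrite binser0.
by rewrite /binser big_ord_recl add0r mul0r mul0r.
Qed.

Lemma binser1M (f : fps R) n : (b 1 * f) n = \sum_(k < n.+1) f k.
Proof.
rewrite mulrC fpsMn; apply: eq_bigr => k _.
by rewrite binser1 mulr1.
Qed.

Lemma sqvar_pairs (f : fps R) n : ((1 + Tv) * fps_sqvar f) n = f n./2.
Proof.
rewrite mulrDl mul1r fpsDn; case: n => [|n].
  by rewrite fpsXM0 addr0.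
rewrite fpsXS /fps_sqvar /= uphalf_half.
by case: (odd n); rewrite /= ?addr0 ?add0r ?add1n ?add0n.
Qed.

Definition pair_ser : fps R := b 1 * fps_map_scale (@ratr R) (16%:R^-1) qone.

(** After t := t/4 the kernel is 1 - t, and 1/(1-t) = (1+t)/(1-t^2), so the series is 1 + t times a
    series in t^2 and its coefficients come in equal pairs. The scale 1/16 in [pair_ser] is
    (1/4)^2. *)
Lemma atotal_pair_ser n : (atotal n)%:R / 4%:R ^+ n = pair_ser n./2.
Proof.
pose A : fps R := fps_map_scale (@ratr R) (4%:R^-1) Aser.
have -> : (atotal n)%:R / 4%:R ^+ n = A n.
  by rewrite /A /fps_map_scale /Aser rmorph_nat exprVn.
rewrite -sqvar_pairs; congr (_ n).
have c0 : (1 - Tv : fps R) 0%N != 0.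
  by rewrite fpsBn fps1n fps_of_polyX0 subr0 oner_eq0.
apply: (fps_mulIf c0).
have -> : A * (1 - Tv) = fps_sqvar (fps_map_scale (@ratr R) (16%:R^-1) qone).
  have -> : 1 - Tv = fps_map_scale (@ratr R) (4%:R^-1) (1 - 4%:R * Tv).
    rewrite rmorphB rmorph1 rmorphM rmorph_nat /= fps_map_scaleX mulrA.
    by rewrite -natr_fps -rmorphM -polyCM mulfV ?rmorph1 ?mul1r // pnatr_eq0.
  rewrite -rmorphM Aser_kernel; apply: fpsP => k.
  rewrite -[LHS]/(ratr (fps_sqvar qone k) * 4%:R^-1 ^+ k).
  rewrite /fps_sqvar; case: (boolP (odd k)) => ok; first by rewrite rmorph0 mul0r.
  rewrite /fps_map_scale; congr (_ * _).
  rewrite -[in LHS](even_halfK ok) -mul2n exprM exprVn -natrX.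
  by [].
rewrite /pair_ser rmorphM /=.
transitivity (fps_sqvar (b 1) * (1 - Tv * Tv) *
  fps_sqvar (fps_map_scale (@ratr R) (16%:R^-1) qone)); last by ring.
rewrite -fps_sqvarX -(rmorph1 (@fps_sqvar R)) -rmorphB -rmorphM /= binser1_inv.
by rewrite rmorph1 mul1r.
Qed.

Lemma pair_ser0 : pair_ser 0%N = 1.
Proof.
by rewrite /pair_ser fpsMn0 binser0 fps_map_scale0 qone0 rmorph1 mul1r.
Qed.

Lemma pair_ser_ge0 n : 0 <= pair_ser n.
Proof.
by rewrite -(doubleK n) -atotal_pair_ser divr_ge0 // exprn_ge0.
Qed.

Lemma pair_ser_sqr : 2%:R * (pair_ser * pair_ser) = b 1 + b (3%:R / 2%:R).
Proof.
pose s : fps rat -> fps R := fps_map_scale (@ratr R) (16%:R^-1).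
have sM f g : s (f * g) = s f * s g by rewrite /s rmorphM.
have sD f g : s (f + g) = s f + s g by rewrite /s rmorphD.
have sN f : s (- f) = - s f by rewrite /s rmorphN.
have sn k : s k%:R = k%:R by rewrite /s rmorph_nat.
have s1 : s 1 = 1 by rewrite /s rmorph1.
have sT : 16%:R * s Tv = Tv.
  rewrite /s fps_map_scaleX mulrA.
  by rewrite -natr_fps -rmorphM -polyCM mulfV ?rmorph1 ?mul1r // pnatr_eq0.
have sP : s Psqrt = b (- 2%:R^-1).
  apply: fps_sqr_inj; rewrite ?pnatr_eq0 //.
  - by rewrite /s fps_map_scale0 PsqrtP.1 rmorph1.
  - by rewrite binser0.
  rewrite binserD -sM PsqrtP.2 sD sN sM sn s1 sT -binser_neg1; congr b.
  by field.
transitivity (b 1 * b 1 * s (2%:R * (qone * qone))).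
  by rewrite /pair_ser -/s sM sn sM; ring.
rewrite qone_sqr !(sD, sN, sM, sn, s1) sT sP -binser_neg1 mulrDr !binserD.
by congr (b _ + b _); field.
Qed.

Lemma binser_step1 a : b (a + 1) = b a + Tv * b (a + 1).
Proof.
apply/eqP; rewrite -subr_eq -{1}[b _]mul1r -mulrBl -binser_neg1 binserD.
by apply/eqP; congr b; ring.
Qed.

(** Logarithmic differentiation of [pair_ser_sqr]: once multiplied by 4 e, both sides are
    combinations of powers of 1 - T. *)
Lemma pair_ser_euler :
  4%:R * fps_euler pair_ser = pair_ser * (3%:R * Tv * b 1 - b (2%:R^-1) + 1).
Proof.
set e := pair_ser.
have e0 : (4%:R * e) 0%N != 0 by rewrite fpsMn0 fps_natr0 /e pair_ser0 mulr1 pnatr_eq0.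
apply: (fps_mulIf e0).
have E2 : 2%:R * (fps_euler e * e + e * fps_euler e) =
    fps_euler (b 1) + fps_euler (b (3%:R / 2%:R)).
  rewrite -fps_eulerM -fps_eulerD -pair_ser_sqr -natr_fps.
  by apply: fpsP => n; rewrite fpsCM /fps_euler fpsCM mulrCA.
transitivity (4%:R * (2%:R * (fps_euler e * e + e * fps_euler e))); first by ring.
rewrite E2 !fps_euler_binser.
transitivity (2%:R * (2%:R * (e * e)) * (3%:R * Tv * b 1 - b (2%:R^-1) + 1)); last by ring.
rewrite pair_ser_sqr.
have b2 : b (1 + 1) = b 1 + Tv * b (1 + 1) := binser_step1 1.
have M1 : b 1 * b 1 = b (1 + 1) by rewrite binserD.
have M2 : b (3%:R / 2%:R) * b 1 = b (3%:R / 2%:R + 1) by rewrite binserD.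
have M3 : b 1 * b (2%:R^-1) = b (3%:R / 2%:R) by rewrite binserD; congr b; field.
have M4 : b (3%:R / 2%:R) * b (2%:R^-1) = b (1 + 1) by rewrite binserD; congr b; field.
have c32 : 2%:R * fcst (3%:R / 2%:R) = 3%:R :> fps R.
  by rewrite -!natr_fps -rmorphM -polyCM; congr (fps_of_poly _%:P); field.
transitivity (4%:R * (Tv * b (1 + 1)) + 2%:R * (2%:R * fcst (3%:R / 2%:R)) * (Tv * b (3%:R / 2%:R + 1))).
  by rewrite rmorph1; ring.
rewrite c32.
transitivity (2%:R * (3%:R * Tv * (b 1 * b 1) + 3%:R * Tv * (b (3%:R / 2%:R) * b 1)
  - b 1 * b (2%:R^-1) - b (3%:R / 2%:R) * b (2%:R^-1) + b 1 + b (3%:R / 2%:R))); last by ring.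
rewrite M1 M2 M3 M4 [in X in _ - X + _ + _]b2; ring.
Qed.

End NormalizedSeries.

(** * The Gamma integral and bounds for the binomial coefficients *)

Section GammaFunction.
Variable R : realType.
Implicit Types s u : R.
Local Notation mu := (@lebesgue_measure R).

Definition gamma_fun (s u : R) : R := u `^ (s - 1) * expR (- u).

(** Extended real values let the functional equation be proved before finiteness, which [egamma34]
    then deduces from it. *)
Definition egamma (s : R) : \bar R :=
  (\int[mu]_(u in `]0%R, +oo[%classic) (gamma_fun s u)%:E)%E.

Lemma gamma_fun_ge0 s u : 0 <= gamma_fun s u.
Proof. by rewrite mulr_ge0 ?powR_ge0 ?expR_ge0. Qed.

Lemma measurable_gamma_fun s (D : set R) : measurable_fun D (gamma_fun s).
Proof.
apply: measurable_funTS; rewrite /gamma_fun; apply: measurable_funM => /=; first exact: measurable_powR.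
by apply: measurableT_comp => //; exact: oppr_measurable.
Qed.

Lemma gamma_fun_derive s (u : R) : 0 < u ->
  is_derive u 1 (gamma_fun (s + 1)) (s * gamma_fun s u - gamma_fun (s + 1) u).
Proof.
move=> u0; have p := is_derive1_powR s u0.
rewrite /gamma_fun addrK; apply: is_derive_eq.
by rewrite /GRing.scale /=; ring.
Qed.

Lemma gamma_fun_continuous s (u : R) : 0 < u -> {for u, continuous (gamma_fun s)}.
Proof.
move=> u0; have [d _] := gamma_fun_derive (s - 1) u0.
by move: d; rewrite subrK => /derivable1_diffP/differentiable_continuous.
Qed.

Lemma gamma_fun_within s (a c : R) : 0 < a -> {within `[a, c], continuous (gamma_fun s)}.
Proof.
move=> a0; apply: continuous_in_subspaceT => x; rewrite inE/= in_itv/= => /andP[ax _].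
exact: gamma_fun_continuous (lt_le_trans a0 ax).
Qed.

(** Integration by parts, as the fundamental theorem of calculus for [gamma_fun (s + 1)], on a
    segment away from the possible singularity at 0. *)
Lemma gamma_fun_parts s (a c : R) : 0 < s -> 0 < a -> a < c ->
  (s%:E * \int[mu]_(u in `[a, c]) (gamma_fun s u)%:E =
   \int[mu]_(u in `[a, c]) (gamma_fun (s + 1) u)%:E +
   (gamma_fun (s + 1) c - gamma_fun (s + 1) a)%:E)%E.
Proof.
move=> s0 a0 ac.
pose f u := s * gamma_fun s u - gamma_fun (s + 1) u.
have cf : {within `[a, c], continuous f}.
  apply: continuous_in_subspaceT => x; rewrite inE/= in_itv/= => /andP[ax _].
  have x0 := lt_le_trans a0 ax.
  apply: cvgB; last exact: gamma_fun_continuous.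
  by apply: cvgM; [exact: cvg_cst|exact: gamma_fun_continuous].
have E := @continuous_FTC2 R f (gamma_fun (s + 1)) a c ac cf.
have igr t : mu.-integrable `[a, c] (EFin \o gamma_fun t).
  apply: continuous_compact_integrable; first exact: segment_compact.
  exact: gamma_fun_within.
rewrite EFinB -E; last 2 first.
- split=> [x|/=|/=].
  + rewrite in_itv/= => /andP[ax _]; have [] // := gamma_fun_derive s (lt_trans a0 ax).
  + by apply: cvg_at_right_filter; exact: gamma_fun_continuous.
  + by apply: cvg_at_left_filter; apply: gamma_fun_continuous; exact: lt_trans ac.
- move=> x; rewrite in_itv/= => /andP[ax _]; have [_] := gamma_fun_derive s (lt_trans a0 ax).
  by rewrite derive1E.
rewrite /f; under [X in (_ + X)%E]eq_integral do rewrite EFinB EFinM.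
rewrite integralB//=; last first.
- exact: igr.
- by apply: integrableZl => //; exact: igr.
rewrite integralZl//; last exact: igr.
rewrite addeC subeK//; apply: integrable_fin_num => //; exact: igr.
Qed.


(** The lower end 1/(n+1) is at most 1; the upper end n + 2 makes the segment nondegenerate even at
    n = 0. *)
Definition gamma_seg n : set R := `[harmonic n, n.+2%:R]%classic.

Lemma gamma_segE : \bigcup_n gamma_seg n = `]0, +oo[%classic.
Proof.
apply/seteqP; split=> x; rewrite /gamma_seg /= in_itv/= andbT.
  by move=> [n _]; rewrite /= in_itv/= => /andP[+ _]; apply: lt_le_trans; rewrite invr_gt0.
move=> x0.
have [k xk] : exists k : nat, x + x^-1 < k%:R.
  by exists (Num.bound (x + x^-1)); apply: archi_boundP; rewrite addr_ge0 ?invr_ge0 // ltW.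
exists k => //=.
have xi0 : 0 < x^-1 by rewrite invr_gt0.
rewrite in_itv/= -[X in _ <= X <= _]invrK lef_pV2 ?posrE ?ltr0n // invrK -!natr1.
by apply/andP; split; lra.
Qed.

Lemma gamma_seg_nd : nondecreasing_seq gamma_seg.
Proof.
apply/nondecreasing_seqP => n; rewrite subsetEset => x.
rewrite /gamma_seg /= !in_itv/= => /andP[nx xn]; apply/andP; split.
  by apply: le_trans nx; rewrite lef_pV2 ?posrE // ler_nat.
by apply: le_trans xn _; rewrite ler_nat.
Qed.

Lemma gamma_seg_cvg s :
  (\int[mu]_(u in gamma_seg n) (gamma_fun s u)%:E)%E @[n --> \oo] --> egamma s.
Proof.
rewrite /egamma -gamma_segE; apply: ge0_nondecreasing_set_cvg_integral.
- exact: gamma_seg_nd.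
- by move=> n; exact: measurable_itv.
- by move=> n; apply/measurable_EFinP; exact: measurable_gamma_fun.
- by move=> n x _; rewrite lee_fin gamma_fun_ge0.
Qed.

Lemma gamma_fun_cvg0 s : 0 < s -> gamma_fun (s + 1) (harmonic n) @[n --> \oo] --> (0 : R).
Proof.
move=> s0; apply: (@squeeze_cvgr _ _ _ _ (fun=> 0) (fun n => harmonic n `^ s)).
- apply: nearW => n; rewrite gamma_fun_ge0 /= /gamma_fun addrK ler_piMr ?powR_ge0 //.
- exact: cvg_cst.
- have /cvg_at_rightP := powR_cvg0 s0; apply; split; last exact: cvg_harmonic.
  by move=> n; rewrite invr_gt0.
Qed.

(** For u >= 1 and N >= s, u^s <= u^N while exp u >= u^(N+1)/(N+1)!, so the value is at most
    (N+1)!/u. *)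
Lemma gamma_fun_cvgy s : 0 < s -> gamma_fun (s + 1) n.+2%:R @[n --> \oo] --> (0 : R).
Proof.
move=> s0; pose N := Num.bound s.
apply: (@squeeze_cvgr _ _ _ _ (fun=> 0) (fun n => N.+1`!%:R * harmonic n)).
- apply: nearW => n; rewrite gamma_fun_ge0 /= /gamma_fun addrK.
  set u : R := n.+2%:R; have u1 : 1 <= u by rewrite ler1n.
  have u0 : 0 < u by exact: lt_le_trans u1.
  have uN : u `^ s <= u ^+ N.
    rewrite -(powR_mulrn _ (ltW u0)); apply: ler_powR => //.
    by rewrite ltW // archi_boundP // ltW.
  rewrite expRN ler_pdivrMr ?expR_gt0 //; apply: le_trans uN _.
  have fN : 0 < N.+1`!%:R :> R by rewrite ltr0n fact_gt0.
  apply: (@le_trans _ _ (N.+1`!%:R * u^-1 * (u ^+ N.+1 / N.+1`!%:R))).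
    rewrite exprS le_eqVlt; apply/orP; left; apply/eqP; field.
    by rewrite !gt_eqF.
  apply: ler_pM.
  + by rewrite mulr_ge0 ?ltW ?invr_gt0.
  + by rewrite divr_ge0 ?exprn_ge0 ?ltW.
  + by rewrite ler_pM2l // lef_pV2 ?posrE // ler_nat.
  + by apply: le_trans (expR_ge1Dxn N (ltW u0)); rewrite lerDr.
- exact: cvg_cst.
- rewrite -[X in _ --> X](mulr0 N.+1`!%:R); apply: cvgM; first exact: cvg_cst.
  exact: cvg_harmonic.
Qed.

Lemma egammaS s : 0 < s -> egamma (s + 1) = (s%:E * egamma s)%E.
Proof.
move=> s0.
have L : (s%:E * \int[mu]_(u in gamma_seg n) (gamma_fun s u)%:E)%E @[n --> \oo]
    --> (s%:E * egamma s)%E by exact: cvgeZl _ (gamma_seg_cvg (s := s)).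
apply: (cvg_unique (@ereal_hausdorff R) _ L); rewrite /mkset.
under eq_cvg => n.
  rewrite gamma_fun_parts ?invr_gt0 //; last first.
    by apply: (@le_lt_trans _ _ 1); rewrite ?invf_le1 ?ler1n ?ltr1n.
  over.
rewrite -[egamma (s + 1)]adde0; apply: cvgeD.
- by rewrite fin_num_adde_defl.
- exact: gamma_seg_cvg.
- apply: cvg_EFin; first exact: nearW.
  rewrite -[0]subr0; apply: cvgB; [exact: gamma_fun_cvgy|exact: gamma_fun_cvg0].
Qed.

Lemma egamma1 : egamma 1 = 1%E.
Proof.
rewrite /egamma integral_itv_obnd_cbnd; last first.
  by apply/measurable_EFinP; exact: measurable_gamma_fun.
have d (x : R) : is_derive x 1 (fun u : R => - expR (- u)) (expR (- x)).
  by apply: is_derive_eq; rewrite /GRing.scale /=; ring.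
have dc (x : R) : {for x, continuous (fun u : R => - expR (- u))}.
  by have [+ _] := d x; move=> /derivable1_diffP/differentiable_continuous.
under eq_integral do rewrite /gamma_fun subrr powRr0 mul1r.
rewrite (@ge0_continuous_FTC2y _ _ (fun u : R => - expR (- u)) 0 0).
- by rewrite oppr0 expR0 -EFinB sub0r opprK.
- by move=> x _; exact: expR_ge0.
- apply: continuous_subspaceT => x.
  by apply: continuous_comp; [exact: opp_continuous|exact: continuous_expR].
- rewrite -[X in _ --> X]oppr0; apply: cvgN; exact: cvgr_expR.
- by move=> x _; have [] := d x.
- by apply: cvg_at_right_filter; exact: dc.
- by move=> x _; have [_] := d x; rewrite derive1E.
Qed.

Lemma egamma_fact n : egamma n.+1%:R = (n`!%:R)%:E.
Proof.
elim: n => [|n IHn]; first by rewrite egamma1.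
by rewrite -natr1 egammaS // IHn -EFinM -natrM -factS.
Qed.

Lemma egamma_ge0 s : (0 <= egamma s)%E.
Proof. by apply: integral_ge0 => x _; rewrite lee_fin gamma_fun_ge0. Qed.

Lemma GammaE s : Gamma s = fine (egamma s). Proof. by []. Qed.

Lemma egamma_le (a c d s t v : R) : 0 <= a -> 0 <= c -> 0 <= d ->
  (forall u, 0 < u -> a * u `^ (s - 1) <= c * u `^ (t - 1) + d * u `^ (v - 1)) ->
  (a%:E * egamma s <= c%:E * egamma t + d%:E * egamma v)%E.
Proof.
move=> a0 c0 d0 H.
have mI : measurable (`]0%R, +oo[%classic : set R) by exact: measurable_itv.
have mf t' : measurable_fun (`]0%R, +oo[%classic : set R) (EFin \o gamma_fun t').
  by apply/measurable_EFinP; exact: measurable_gamma_fun.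
have f0 t' (x : R) : (0 <= (gamma_fun t' x)%:E)%E by rewrite lee_fin gamma_fun_ge0.
have m0 k t' x : 0 <= k -> (0 <= k%:E * (gamma_fun t' x)%:E)%E.
  by move=> k0; rewrite mule_ge0 // lee_fin.
rewrite /egamma -!ge0_integralZl_EFin //; try exact: mf.
rewrite -ge0_integralD //; last 4 first.
- by move=> x _; apply: m0.
- by apply: measurable_funeM; exact: mf.
- by move=> x _; apply: m0.
- by apply: measurable_funeM; exact: mf.
apply: ge0_le_integral => //.
- by move=> x _; apply: m0.
- by apply: measurable_funeM; exact: mf.
- by apply: emeasurable_funD; apply: measurable_funeM; exact: mf.
move=> x /=; rewrite in_itv/= andbT => x0.
rewrite -!EFinM -EFinD lee_fin /gamma_fun !mulrA -mulrDl.
by rewrite ler_pM2r ?expR_gt0 // H.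
Qed.

Local Notation Gamma34 := (Gamma (3%:R / 4%:R) : R).

(** From u^(3/4) <= 1 + u, Gamma(7/4) is at most Gamma(1) + Gamma(2); the functional equation
    carries finiteness down to 3/4. *)
Lemma egamma34 : egamma (3%:R / 4%:R) = Gamma34%:E.
Proof.
rewrite GammaE fineK // ge0_fin_numE ?egamma_ge0 //.
have H := @egamma_le 1 1 1 (3%:R / 4%:R + 1) 1 2%:R ler01 ler01 ler01.
have /H : forall u, 0 < u -> 1 * u `^ (3%:R / 4%:R + 1 - 1) <=
    1 * u `^ (1 - 1) + 1 * u `^ (2%:R - 1).
  move=> u u0; rewrite !mul1r addrK subrr powRr0.
  have -> : 2%:R - 1 = 1 :> R by ring.
  rewrite (powRr1 (ltW u0)); have [u1|u1] := leP u 1.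
    apply: (@le_trans _ _ 1); last by rewrite lerDl ltW.
    by rewrite -[leRHS](powRr0 u); apply: ger_powR; rewrite ?u0 ?divr_ge0.
  apply: (@le_trans _ _ u); last by rewrite lerDr.
  by apply: ler1_powR; [exact: ltW|rewrite ler_pdivrMr // mul1r ler_nat].
rewrite !mul1e egamma1 (egamma_fact 1) egammaS; last by rewrite divr_gt0.
case: (egamma _) (egamma_ge0 (3%:R / 4%:R)) => [r _ _||//]; first by rewrite ltry.
by rewrite mulry gtr0_sg ?mul1e // -?EFinD ?leye_eq //; lra.
Qed.

Lemma egamma34_binser n :
  egamma (n%:R + 3%:R / 4%:R) = (Gamma34 * binser (3%:R / 4%:R) n * n`!%:R)%:E.
Proof.
elim: n => [|n IHn]; first by rewrite add0r egamma34 binser0 !mulr1.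
rewrite -natr1 addrAC egammaS; last by have := ler0n R n; lra.
rewrite IHn -EFinM factS natrM; congr (_%:E).
transitivity (Gamma34 * (n.+1%:R * binser (3%:R / 4%:R) n.+1) * n`!%:R); last by ring.
by rewrite binserSE; ring.
Qed.

Lemma powR_quarter u k : u `^ (k%:R / 4%:R) = (u `^ (4%:R^-1)) ^+ k.
Proof. by rewrite mulrC powRrM powR_mulrn // powR_ge0. Qed.

(* Both bounds compare [u `^ (n - 1/4)] with integral powers of [u], through
   [4 x ^+ 3 <= 3 x ^+ 4 + 1] and [5 x <= x ^+ 5 + 4] at a multiple [x] of
   [u `^ (1/4)]. *)
Lemma Gamma34_binser_bounds n :
  n.+1%:R `^ (4%:R^-1) * (Gamma34 * binser (3%:R / 4%:R) n.+1) <= 1 <=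
  n.+2%:R `^ (4%:R^-1) * (Gamma34 * binser (3%:R / 4%:R) n.+1).
Proof.
have root4 (k : nat) : exists m : R, [/\ 0 < m, m ^+ 4 = k.+1%:R & k.+1%:R `^ (4%:R^-1) = m].
  exists (k.+1%:R `^ (4%:R^-1)); split=> //.
  by rewrite -powR_quarter divff // powRr1.
have expo (k : nat) (q : R) u : q = k%:R / 4%:R -> u `^ q = (u `^ (4%:R^-1)) ^+ k.
  by move=> ->; exact: powR_quarter.
set y := Gamma34 * _; have f0 : 0 < n.+1`!%:R :> R by rewrite ltr0n fact_gt0.
have Ey : egamma (n.+1%:R + 3%:R / 4%:R) = (y * n.+1`!%:R)%:E by exact: egamma34_binser.
have n0 : 0 <= n%:R :> R by [].
have e1 u : u `^ (n.+1%:R + 3%:R / 4%:R - 1) = (u `^ (4%:R^-1)) ^+ (n * 4 + 3).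
  by apply: expo; rewrite natrD natrM -natr1; field.
have e2 u : u `^ (n.+2%:R - 1) = (u `^ (4%:R^-1)) ^+ (n * 4 + 4).
  by apply: expo; rewrite natrD natrM -!natr1; field.
have e3 u : u `^ (n.+1%:R - 1) = (u `^ (4%:R^-1)) ^+ (n * 4).
  by apply: expo; rewrite natrM -!natr1; field.
have e4 u : u `^ (n.+3%:R - 1) = (u `^ (4%:R^-1)) ^+ (n * 4 + 8).
  by apply: expo; rewrite natrD natrM -!natr1; field.
apply/andP; split.
(* Here m^4 = n + 1; integration yields 4 m y (n+1)! <= 3 (n+1)! + (n+1) n! = 4 (n+1)!. *)
- have [m [m0 m4 ->]] := root4 n.
  have H : forall u, 0 < u -> 4%:R * m * u `^ (n.+1%:R + 3%:R / 4%:R - 1) <=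
      3%:R * u `^ (n.+2%:R - 1) + n.+1%:R * u `^ (n.+1%:R - 1).
    move=> u u0; rewrite e1 e2 e3 -m4.
    set v := u `^ _; have v0 : 0 < v by rewrite powR_gt0.
    rewrite !exprD; move: (v ^+ (n * 4)) (exprn_gt0 (n * 4) v0) => w w0.
    have q : 0 <= 3%:R * v ^+ 4 + m ^+ 4 - 4%:R * m * v ^+ 3.
      have -> : 3%:R * v ^+ 4 + m ^+ 4 - 4%:R * m * v ^+ 3 =
        (v - m) ^+ 2 * (2%:R * v ^+ 2 + (v + m) ^+ 2) by ring.
      by rewrite mulr_ge0 ?sqr_ge0 // addr_ge0 ?sqr_ge0 // mulr_ge0 ?sqr_ge0.
    rewrite -subr_ge0; have -> : 3%:R * (w * v ^+ 4) + m ^+ 4 * w - 4%:R * m * (w * v ^+ 3)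
      = w * (3%:R * v ^+ 4 + m ^+ 4 - 4%:R * m * v ^+ 3) by ring.
    by rewrite mulr_ge0 // ltW.
  have a0 : 0 <= 4%:R * m by rewrite mulr_ge0 // ltW.
  have := egamma_le a0 (ler0n R 3) (ler0n R n.+1) H.
  rewrite Ey !egamma_fact -!EFinM -EFinD lee_fin -[n.+1%:R * _]natrM -factS => K.
  by rewrite -(ler_pM2r f0) -(ler_pM2l (_ : 0 < 4%:R :> R)) //; lra.
(* Here m^4 = n + 2, so that (n+2)! = m^4 (n+1)! cancels one of the five copies on the left. *)
- have [m [m0 m4 ->]] := root4 n.+1.
  have m40 := exprn_gt0 4 m0.
  have H : forall u, 0 < u -> 5%:R * m ^+ 4 * u `^ (n.+2%:R - 1) <=
      1 * u `^ (n.+3%:R - 1) + 4%:R * m ^+ 5 * u `^ (n.+1%:R + 3%:R / 4%:R - 1).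
    move=> u u0; rewrite e1 e2 e4.
    set v := u `^ _; have v0 : 0 < v by rewrite powR_gt0.
    rewrite !exprD; move: (v ^+ (n * 4)) (exprn_gt0 (n * 4) v0) => w w0.
    have q : 0 <= v ^+ 5 + 4%:R * m ^+ 5 - 5%:R * m ^+ 4 * v.
      have -> : v ^+ 5 + 4%:R * m ^+ 5 - 5%:R * m ^+ 4 * v =
        (v - m) ^+ 2 * (v ^+ 3 + 2%:R * v ^+ 2 * m + 3%:R * v * m ^+ 2 + 4%:R * m ^+ 3) by ring.
      by rewrite mulr_ge0 ?sqr_ge0 // !addr_ge0 // ?mulr_ge0 ?exprn_ge0 // ltW.
    rewrite -subr_ge0; have -> : 1 * (w * v ^+ 8) + 4%:R * m ^+ 5 * (w * v ^+ 3) -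
        5%:R * m ^+ 4 * (w * v ^+ 4)
      = w * v ^+ 3 * (v ^+ 5 + 4%:R * m ^+ 5 - 5%:R * m ^+ 4 * v) by ring.
    by rewrite !mulr_ge0 ?exprn_ge0 // ltW.
  have a0 : 0 <= 5%:R * m ^+ 4 by rewrite mulr_ge0 // ltW.
  have d0 : 0 <= 4%:R * m ^+ 5 by rewrite mulr_ge0 // exprn_ge0 // ltW.
  have := egamma_le a0 ler01 d0 H.
  rewrite Ey !egamma_fact -!EFinM -EFinD lee_fin mul1r (factS n.+1) natrM -m4 => K.
  rewrite -(ler_pM2r f0) -(ler_pM2l m40) mul1r.
  have E : 5%:R * m ^+ 4 * n.+1`!%:R <= m ^+ 4 * n.+1`!%:R + 4%:R * (m ^+ 4 * (m * y * n.+1`!%:R)).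
    by apply: le_trans K _; rewrite le_eqVlt; apply/orP; left; apply/eqP; ring.
  lra.
Qed.

End GammaFunction.

(** * Limits of coefficient ratios *)

Section Limits.
Variable R : realType.
Local Notation b := (@binser R).
Local Notation e := (pair_ser R).

Lemma binser_gt0 a n : 0 < a -> 0 < b a n.
Proof.
move=> a0; apply: prodr_gt0 => i _.
by rewrite divr_gt0 ?ltr0n // ltr_wpDr.
Qed.

(** Raising the exponent by 1/2 gains a factor of order sqrt n. The induction step is (a+n)(a+n+1)
    <= (a+n+1/2)^2. *)
Lemma binser_half_step a n : 0 < a ->
  b a n ^+ 2 * (a + n%:R) <= a * b (a + 2%:R^-1) n ^+ 2.
Proof.
move=> a0; elim: n => [|n IHn]; first by rewrite !binser0 expr1n addr0 mul1r mulr1.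
have n0 : 0 <= n%:R :> R by [].
have n1 : 0 < n.+1%:R ^+ 2 :> R by rewrite exprn_gt0 // ltr0n.
rewrite -(ler_pM2l n1).
have -> : n.+1%:R ^+ 2 * (b a n.+1 ^+ 2 * (a + n.+1%:R)) =
   b a n ^+ 2 * (a + n%:R) * ((a + n%:R) * (a + n%:R + 1)).
  transitivity ((n.+1%:R * b a n.+1) ^+ 2 * (a + n.+1%:R)); first by ring.
  by rewrite binserSE -natr1; ring.
have -> : n.+1%:R ^+ 2 * (a * b (a + 2%:R^-1) n.+1 ^+ 2) =
   a * b (a + 2%:R^-1) n ^+ 2 * (a + n%:R + 2%:R^-1) ^+ 2.
  transitivity (a * (n.+1%:R * b (a + 2%:R^-1) n.+1) ^+ 2); first by ring.
  by rewrite binserSE; ring.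
apply: ler_pM => //.
- by rewrite mulr_ge0 ?sqr_ge0 // addr_ge0 // ltW.
- by rewrite mulr_ge0 // ?addr_ge0 // ltW.
by rewrite -subr_ge0 (_ : _ - _ = (2%:R^-1) ^+ 2); [exact: sqr_ge0|field].
Qed.

Lemma cvg0_sqr_le_harmonic (c : R) (f : R^nat) : (forall n, 0 <= f n) ->
  (forall n, f n ^+ 2 <= c * harmonic n) -> f n @[n --> \oo] --> (0 : R).
Proof.
move=> f0 fc.
apply: (@squeeze_cvgr _ _ _ _ (fun=> 0) (fun n => Num.sqrt (c * harmonic n))).
- by apply: nearW => n; rewrite f0 /= -[f n]ger0_norm // -sqrtr_sqr ler_wsqrtr.
- exact: cvg_cst.
- have H : c * harmonic n @[n --> \oo] --> (0 : R).
    by rewrite -[X in _ --> X](mulr0 c); apply: cvgM; [exact: cvg_cst|exact: cvg_harmonic].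
  rewrite -[X in _ --> X]sqrtr0; apply: (continuous_cvg _ _ H).
  exact: sqrt_continuous.
Qed.

Lemma binser_half_cvg0 : b (2%:R^-1) n @[n --> \oo] --> (0 : R).
Proof.
apply: (@cvg0_sqr_le_harmonic 1) => n; first by rewrite ltW // binser_gt0.
have := @binser_half_step (2%:R^-1) n.
rewrite (_ : 2%:R^-1 + 2%:R^-1 = 1); last by field.
rewrite binser1 expr1n mulr1 mul1r invr_gt0 ltr0n => /(_ isT) H.
have n0 : 0 <= n%:R :> R by [].
have n1 : 0 < n.+1%:R :> R by rewrite ltr0n.
rewrite /harmonic /= -[leRHS]mul1r ler_pdivlMr // -natr1.
by have := sqr_ge0 (b 2^-1 n); nra.
Qed.

Definition wser : fps R := e * b (- (3%:R / 4%:R)).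
Definition hser : fps R := 1 - wser.
Local Notation h := hser.

Lemma wserE : wser * b (3%:R / 4%:R) = e.
Proof. by rewrite /wser -mulrA binserD addNr binserZ0 mulr1. Qed.

Lemma wser_sqr : 2%:R * (wser * wser) = 1 + b (- 2%:R^-1).
Proof.
transitivity (2%:R * (e * e) * (b (- (3%:R / 4%:R)) * b (- (3%:R / 4%:R)))).
  by rewrite /wser; ring.
rewrite pair_ser_sqr mulrDl !binserD -binserZ0 addrC.
by congr (b _ + b _); field.
Qed.

(** The quadratic equation of w in terms of h = 1 - w. As h(0) = 0 and 1 - (1-T)^(1/2) has
    nonnegative coefficients, it is a recursion showing h nonnegative. *)
Lemma hser_eq : 4%:R * h = 2%:R * (h * h) + 1 - b (- 2%:R^-1).
Proof.
have := wser_sqr; rewrite (_ : wser = 1 - h); last by rewrite /hser; ring.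
move=> E; apply/eqP; rewrite -subr_eq0.
have -> : 4%:R * h - (2%:R * (h * h) + 1 - b (- 2%:R^-1)) =
  1 + b (- 2%:R^-1) - 2%:R * ((1 - h) * (1 - h)) by ring.
by rewrite E subrr.
Qed.

Lemma fps_natrM k (f : fps R) n : (k%:R * f) n = k%:R * f n.
Proof. by rewrite -natr_fps fpsCM. Qed.

Lemma hser0 : h 0%N = 0.
Proof. by rewrite /hser fpsBn fps1n /wser fpsMn0 pair_ser0 binser0 mulr1 subrr. Qed.

Lemma binser_neg_half_le0 n : b (- 2%:R^-1) n.+1 <= 0.
Proof.
rewrite /binser big_ord_recl /= addr0 divr1 pmulr_lle0 ?oppr_le0 ?invr_ge0 //.
apply: prodr_gt0 => i _; rewrite divr_gt0 ?ltr0n // /bump /= natrD.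
have : 0 <= i%:R :> R by [].
have : 2%:R^-1 < 1 :> R by rewrite invf_lt1 ?ltr1n.
lra.
Qed.

Lemma hser_ge0 n : 0 <= h n.
Proof.
elim/ltn_ind: n => -[|n] IHn; first by rewrite hser0.
have := congr1 (fun f : fps R => f n.+1) hser_eq.
rewrite /= fpsBn fpsDn !fps_natrM fps1n addr0 => E.
have q : 0 <= (h * h) n.+1.
  rewrite fpsMn big_ord_recl hser0 mul0r add0r big_ord_recr /= subnn hser0 mulr0 addr0.
  apply: sumr_ge0 => k _; rewrite /bump /= add1n mulr_ge0 //; apply: IHn.
    by rewrite ltnS.
  by rewrite subSS ltnS leq_subr.
by have := binser_neg_half_le0 n; lra.
Qed.

Definition Hser : fps R := b 1 * h.
Local Notation H := Hser.

Lemma HserE n : H n = \sum_(k < n.+1) h k.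
Proof. exact: binser1M. Qed.

Lemma HserS n : H n.+1 = H n + h n.+1.
Proof. by rewrite !HserE big_ord_recr. Qed.

Lemma Hser_nd : nondecreasing_seq H.
Proof. by apply/nondecreasing_seqP => n; rewrite HserS lerDl hser_ge0. Qed.

Lemma Hser_ge0 n : 0 <= H n.
Proof. by rewrite HserE sumr_ge0 // => k _; exact: hser_ge0. Qed.

Lemma Hser_eq n : 4%:R * H n = 2%:R * (h * H) n + 1 - b (2%:R^-1) n.
Proof.
rewrite -!fps_natrM.
have -> : 4%:R * H = 2%:R * (h * H) + b 1 - b (2%:R^-1).
  rewrite /Hser mulrCA hser_eq.
  have -> : b (2%:R^-1) = b 1 * b (- 2%:R^-1) by rewrite binserD; congr b; field.
  by ring.
by rewrite fpsBn fpsDn binser1.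
Qed.

(* The sum of [h], i.e. 1 - w(1). *)
Definition hsum : R := 1 - (Num.sqrt 2%:R)^-1.

Lemma hsumP : [/\ 0 <= hsum, hsum < 1 & 4%:R * hsum = 2%:R * (hsum * hsum) + 1].
Proof.
have s0 : 0 < Num.sqrt 2%:R :> R by rewrite sqrtr_gt0.
have s2 : Num.sqrt 2%:R ^+ 2 = 2%:R :> R by rewrite sqr_sqrtr.
have i0 : 0 < (Num.sqrt 2%:R)^-1 :> R by rewrite invr_gt0.
have i2 : 2%:R * (Num.sqrt 2%:R)^-1 ^+ 2 = 1 :> R.
  by rewrite exprVn s2 mulfV // pnatr_eq0.
rewrite /hsum; move: (_^-1) i0 i2 => i i0 i2; split; [|lra|].
  by rewrite subr_ge0 leNgt; apply/negP => i1; nra.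
apply/eqP; rewrite -subr_eq0.
have -> : 4%:R * (1 - i) - (2%:R * ((1 - i) * (1 - i)) + 1) = 1 - 2%:R * i ^+ 2 by ring.
by rewrite i2 subrr.
Qed.

(** With s = [hsum], induction gives 4 H(n+1) <= 2 H(n+1) s + 1, while 4 s = 2 s^2 + 1. Since h(0) =
    0, the convolution h * H at n + 1 only uses H up to n. *)
Lemma Hser_le n : H n <= hsum.
Proof.
have [s0 s1 sE] := hsumP.
elim: n => [|n IHn]; first by rewrite HserE big_ord1 hser0.
have q : (h * H) n.+1 <= H n.+1 * H n.
  rewrite fpsMn HserE mulr_suml; apply: ler_sum => -[[|k] kn] _ /=.
    by rewrite hser0 !mul0r.
  apply: ler_wpM2l; first exact: hser_ge0.
  by apply: Hser_nd; rewrite subSS leq_subr.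
have b0 : 0 < b (2%:R^-1) n.+1 by apply: binser_gt0; rewrite invr_gt0.
have := Hser_eq n.+1; have := Hser_ge0 n.+1; have := Hser_ge0 n.
by nra.
Qed.

(** A limit l <= [hsum] exists by monotonicity. At index 2n the convolution is at least H(n)^2, so 2
    l^2 + 1 <= 4 l, which excludes l below the smaller root [hsum]. *)
Lemma Hser_cvg : H n @[n --> \oo] --> hsum.
Proof.
have [s0 s1 sE] := hsumP.
have cH : cvgn H.
  apply: nondecreasing_is_cvgn; first exact: Hser_nd.
  by exists hsum => _ [n _ <-]; exact: Hser_le.
have [l Hl] : exists l : R, H n @[n --> \oo] --> l by exists (limn H).
suff <- : l = hsum by [].
have ls : l <= hsum.
  by apply: (cvgr_to_le Hl); apply: nearW => n; exact: Hser_le.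
have dbl : n.*2 @[n --> \oo] --> \oo.
  apply/cvgnyPge => k; near=> n; rewrite -addnn; apply: leq_trans (leq_addr _ _).
  by near: n; exact: nbhs_infty_ge.
have H2 : H n.*2 @[n --> \oo] --> l := cvg_comp _ _ dbl Hl.
have b2 : b (2%:R^-1) n.*2 @[n --> \oo] --> (0 : R) := cvg_comp _ _ dbl binser_half_cvg0.
have key n : 2%:R * (H n * H n) + 1 - b (2%:R^-1) n.*2 <= 4%:R * H n.*2.
  rewrite Hser_eq !lerD2r ler_pM2l // [leRHS]fpsMn [X in X * _]HserE mulr_suml.
  have nn : (n.+1 <= n.*2.+1)%N by rewrite ltnS -addnn leq_addr.
  rewrite (big_ord_widen _ (fun k => h k * H n) nn) big_mkcond; apply: ler_sum => k _.
  have hk := hser_ge0 k; case: ifP => kn; last by rewrite mulr_ge0 // Hser_ge0.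
  by apply: ler_wpM2l => //; apply: Hser_nd; lia.
have c1 : 2%:R * (H n * H n) + 1 - b (2%:R^-1) n.*2 @[n --> \oo] --> 2%:R * (l * l) + 1 - 0.
  apply: cvgB => //; apply: cvgD; last exact: cvg_cst.
  by apply: cvgM; [exact: cvg_cst|exact: cvgM].
have c2 : 4%:R * H n.*2 @[n --> \oo] --> 4%:R * l by apply: cvgM; [exact: cvg_cst|].
have lim : 2%:R * (l * l) + 1 - 0 <= 4%:R * l.
  by apply: (ler_cvg_to c1 c2); apply: nearW => n; exact: key.
apply/eqP; rewrite eq_le ls /=.
by rewrite leNgt; apply/negP => lh; nra.
Unshelve. all: by end_near. Qed.

Local Notation C := (e * b 1).
Local Notation B := (b (7%:R / 4%:R)).

(** Multiplication by 1/(1-T) raises the exponent 3/4 to 7/4, whose coefficients increase; the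
    convolution with h can then be estimated by monotonicity. *)
Lemma pair_serB : C = B - B * h.
Proof.
rewrite -wserE -mulrA binserD (_ : 3%:R / 4%:R + 1 = 7%:R / 4%:R); last by field.
by rewrite /hser; ring.
Qed.

Lemma binser74_gt0 n : 0 < B n. Proof. by apply: binser_gt0; rewrite divr_gt0. Qed.

Lemma binser74_nd : nondecreasing_seq B.
Proof.
apply/nondecreasing_seqP => n; rewrite -(@ler_pM2l _ n.+1%:R) ?ltr0n // binserSE.
rewrite ler_pM2r ?binser74_gt0 // -natr1 addrC lerD2r.
by rewrite ler_pdivlMr // mul1r ler_nat.
Qed.

(** As 7/4 <= 2, B grows no faster than the coefficients n + 1 of (1-T)^(-2). *)
Lemma binser74_ratio n k : B (n + k)%N * n.+1%:R <= B n * (n + k).+1%:R.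
Proof.
elim: k => [|k IHk]; first by rewrite addn0.
rewrite addnS -(@ler_pM2l _ (n + k).+1%:R) ?ltr0n // mulrA binserSE.
have B0 := binser74_gt0 (n + k).
have n0 : 0 <= n.+1%:R :> R by [].
have k0 : 0 <= (n + k)%:R :> R by [].
apply: (@le_trans _ _ ((2%:R + (n + k)%:R) * (B (n + k)%N * n.+1%:R))).
  rewrite -mulrA ler_wpM2r ?mulr_ge0 ?(ltW B0) // lerD2r ler_pdivrMr // -natrM ler_nat.
  by [].
apply: le_trans (ler_wpM2l _ IHk) _; first by rewrite addr_ge0.
by rewrite le_eqVlt -!natr1; apply/orP; left; apply/eqP; ring.
Qed.

Lemma pair_ser_conv_ge n : 1 - hsum <= C n / B n.
Proof.
have B0 := binser74_gt0 n.
rewrite ler_pdivlMr // pair_serB fpsBn mulrBl mul1r lerD2l lerN2.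
apply: (@le_trans _ _ (H n * B n)); last by rewrite ler_wpM2r ?Hser_le // ltW.
rewrite mulrC fpsMn HserE mulr_suml; apply: ler_sum => k _.
by apply: ler_wpM2l; [exact: hser_ge0|apply: binser74_nd; exact: leq_subr].
Qed.

(** Keeping the terms j <= k of the convolution leaves at least H(k) B(n); replacing B(n) by B(n+k)
    costs a relative error k/(n+k+1), by [binser74_ratio]. *)
Lemma pair_ser_conv_le n k : C (n + k)%N / B (n + k)%N <= 1 - H k + k%:R / (n + k).+1%:R.
Proof.
have B0 := binser74_gt0 (n + k).
have nk0 : 0 < (n + k).+1%:R :> R by rewrite ltr0n.
have hB : H k * B n <= (B * h) (n + k)%N.
  rewrite mulrC [X in _ <= X _](mulrC B) fpsMn HserE mulr_sumr.
  have nn : (k.+1 <= (n + k).+1)%N by rewrite ltnS leq_addl.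
  rewrite (big_ord_widen _ (fun j => B n * h j) nn) big_mkcond; apply: ler_sum => j _.
  have hj := hser_ge0 j; case: ifP => jk; last by rewrite mulr_ge0 // ltW ?binser74_gt0.
  by rewrite mulrC; apply: ler_wpM2l => //; apply: binser74_nd; lia.
rewrite ler_pdivrMr // pair_serB fpsBn.
have r := binser74_ratio n k.
have s : B (n + k)%N - B n <= k%:R / (n + k).+1%:R * B (n + k)%N.
  rewrite mulrAC ler_pdivlMr // mulrBl.
  have -> : (n + k).+1%:R = n.+1%:R + k%:R :> R by rewrite -natrD addSn.
  by move: r; rewrite -addSn natrD; lra.
have [_ s1 _] := hsumP.
have H1 := Hser_le k; have H0 := Hser_ge0 k.
have s' : H k * (B (n + k)%N - B n) <= k%:R / (n + k).+1%:R * B (n + k)%N.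
  apply: le_trans s; rewrite ler_piMl //; last lra.
  by rewrite subr_ge0; apply: binser74_nd; exact: leq_addr.
by move: (k%:R / _) ((B * h) _) s' hB => x z; lra.
Qed.

Lemma pair_ser_conv_cvg : C n / B n @[n --> \oo] --> 1 - hsum.
Proof.
apply/cvgrPdist_le => eps eps0.
have e2 : 0 < eps / 2%:R by rewrite divr_gt0.
have /cvgrPdist_le/(_ _ e2) [k _ /(_ k)] := Hser_cvg.
rewrite /= leqnn => /(_ isT); rewrite ger0_norm ?subr_ge0 ?Hser_le // => Hk.
near=> n.
have kn : (k <= n)%N by near: n; exact: nbhs_infty_ge.
have up := pair_ser_conv_le (n - k) k; rewrite subnK // in up.
have n0 : 0 < n.+1%:R :> R by rewrite ltr0n.
have kk : k%:R / n.+1%:R <= eps / 2%:R.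
  rewrite ler_pdivrMr // mulrC -ler_pdivrMr //.
  apply: le_trans (ltW (archi_boundP _)) _; first by rewrite divr_ge0 // ltW.
  rewrite ler_nat; apply: leqW; near: n; exact: nbhs_infty_ge.
have low := pair_ser_conv_ge n.
by rewrite distrC ger0_norm ?subr_ge0 //; move: (C n / B n) (k%:R / _) up kk => c x; lra.
Unshelve. all: by end_near. Qed.

Local Notation b34 := (b (3%:R / 4%:R)).

Lemma pair_ser_le n : e n <= b34 n.
Proof.
have -> : e = b34 - b34 * h by rewrite -{1}wserE /hser; ring.
rewrite fpsBn lerBlDr lerDl fpsMn sumr_ge0 // => k _.
by rewrite mulr_ge0 ?hser_ge0 // ltW // binser_gt0 // divr_gt0.
Qed.

(** The differential equation reads 4 (n+1) e(n+1) = 3 C(n) - D, while 4 (n+1) b34(n+1) = 3 B(n);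
    the remainder D lies between 0 and the coefficient of (1-T)^(-5/4). *)
Lemma pair_ser_ratio_bounds n :
  C n / B n - b (5%:R / 4%:R) n.+1 / B n <= e n.+1 / b34 n.+1 <= C n / B n.
Proof.
pose D := (e * b (2%:R^-1)) n.+1 - e n.+1.
have D0 : 0 <= D.
  rewrite /D fpsMn big_ord_recr /= subnn binser0 mulr1 addrK sumr_ge0 // => k _.
  by rewrite mulr_ge0 ?pair_ser_ge0 // ltW // binser_gt0 // invr_gt0.
have D1 : D <= b (5%:R / 4%:R) n.+1.
  apply: (@le_trans _ _ ((e * b (2%:R^-1)) n.+1)).
    by rewrite /D lerBlDr lerDl pair_ser_ge0.
  rewrite (_ : 5%:R / 4%:R = 3%:R / 4%:R + 2%:R^-1); last by field.
  rewrite -binserD !fpsMn; apply: ler_sum => k _.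
  by rewrite ler_wpM2r ?pair_ser_le // ltW // binser_gt0 // invr_gt0.
have eE : 4%:R * (n.+1%:R * e n.+1) = 3%:R * C n - D.
  have := congr1 (fun f : fps R => f n.+1) (pair_ser_euler R).
  rewrite /= fps_natrM => ->.
  rewrite (_ : e * _ = 3%:R * (Tv * C) - e * b (2%:R^-1) + e); last by ring.
  by rewrite fpsDn fpsBn fps_natrM fpsXS /D opprB addrA addrAC.
have bE : n.+1%:R * b34 n.+1 = 3%:R / 4%:R * B n.
  have := congr1 (fun f : fps R => f n.+1) (fps_euler_binser (3%:R / 4%:R : R)).
  by rewrite /= fpsCM fpsXS (_ : 3%:R / 4%:R + 1 = 7%:R / 4%:R) //; field.
have B0 := binser74_gt0 n.
have b0 : 0 < b34 n.+1 by rewrite binser_gt0 // divr_gt0.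
have -> : e n.+1 / b34 n.+1 = C n / B n - D / 3%:R / B n.
  transitivity (4%:R * (n.+1%:R * e n.+1) / (4%:R * (n.+1%:R * b34 n.+1))).
    by rewrite !mulrA -[RHS]mulf_div divff ?mul1r // mulf_neq0 ?pnatr_eq0.
  by rewrite eE bE; field; rewrite gt_eqF.
have Bi0 : 0 < (B n)^-1 by rewrite invr_gt0.
apply/andP; split; last by rewrite lerBlDr lerDl mulr_ge0 ?divr_ge0 // ltW.
rewrite lerD2l lerN2 ler_pM2r //; apply: le_trans D1.
by rewrite ler_pdivrMr // ler_peMr // ler1n.
Qed.

Lemma binser54_cvg0 : b (5%:R / 4%:R) n.+1 / B n @[n --> \oo] --> (0 : R).
Proof.
(* The constant 2 covers (5/4)^3 = 125/64: two factors come from f1 <= 5/4 f, one from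
   [binser_half_step] at a = 5/4. *)
apply: (@cvg0_sqr_le_harmonic 2%:R) => n.
  by rewrite divr_ge0 ?ltW ?binser74_gt0 // binser_gt0 // divr_gt0.
have a0 : 0 < 5%:R / 4%:R :> R by rewrite divr_gt0.
have := binser_half_step n a0.
rewrite (_ : 5%:R / 4%:R + 2%:R^-1 = 7%:R / 4%:R); last by field.
have := binserSE (5%:R / 4%:R : R) n.
have B0 := binser74_gt0 n; have b0 := binser_gt0 n a0.
have n0 : 0 <= n%:R :> R by [].
have n1 : 0 < n.+1%:R :> R by rewrite ltr0n.
move: (b _ n) (B n) (b _ n.+1) B0 b0 => f g f1 g0 f0 E q.
rewrite expr_div_n ler_pdivrMr ?exprn_gt0 // /harmonic /= mulrAC ler_pdivlMr //.
have f1E : f1 <= 5%:R / 4%:R * f.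
  rewrite -(ler_pM2l n1) E mulrA ler_pM2r // -[n.+1%:R]natr1; lra.
have f10 : 0 <= f1.
  by rewrite -(pmulr_rge0 _ n1) E mulr_ge0 ?addr_ge0 // ltW.
have f12 : f1 ^+ 2 <= (5%:R / 4%:R * f) ^+ 2.
  by rewrite ler_pXn2r // nnegrE mulr_ge0 // ltW.
apply: (@le_trans _ _ ((5%:R / 4%:R * f) ^+ 2 * (5%:R / 4%:R + n%:R))).
  apply: ler_pM => //; first exact: sqr_ge0.
  by rewrite -[n.+1%:R]natr1 addrC lerD2r ler_pdivlMr // mul1r ler_nat.
have -> : (5%:R / 4%:R * f) ^+ 2 * (5%:R / 4%:R + n%:R) =
   25%:R / 16%:R * (f ^+ 2 * (5%:R / 4%:R + n%:R)) by field.
have := sqr_ge0 g; lra.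
Qed.

Lemma pair_ser_ratio_cvg : e n / b34 n @[n --> \oo] --> (Num.sqrt 2%:R)^-1.
Proof.
rewrite -cvg_shiftS.
have -> : (Num.sqrt 2%:R)^-1 = 1 - hsum by rewrite /hsum opprB addrC subrK.
apply: (squeeze_cvgr (f := fun n => C n / B n - b (5%:R / 4%:R) n.+1 / B n)
  (h := fun n => C n / B n)).
- by apply: nearW => n; exact: pair_ser_ratio_bounds.
- rewrite -[X in _ --> X]subr0; apply: cvgB; last exact: binser54_cvg0.
  exact: pair_ser_conv_cvg.
- exact: pair_ser_conv_cvg.
Qed.

Lemma norm_sub1_le_pow4 (t : R) : 0 <= t -> `|t - 1| <= `|t ^+ 4 - 1|.
Proof.
move=> t0; have -> : t ^+ 4 - 1 = (t - 1) * ((t + 1) * (t ^+ 2 + 1)) by ring.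
rewrite normrM ler_peMr // ger0_norm.
  by have := sqr_ge0 t; nra.
by rewrite mulr_ge0 ?addr_ge0 ?sqr_ge0.
Qed.

Lemma half_cvgn : n./2 @[n --> \oo] --> \oo.
Proof.
apply/cvgnyPge => k; near=> n.
by rewrite geq_half_double; near: n; exact: nbhs_infty_ge.
Unshelve. all: by end_near. Qed.

(** Compare fourth powers ([norm_sub1_le_pow4]). With m + 1 = floor (n/2) and y = Gamma(3/4)
    b34(m+1), the fourth power is n y^4 / 2, where (m+1) y^4 <= 1 <= (m+2) y^4 and n is 2(m+1) or
    2(m+1) + 1; the error is at most 1/(m+1). *)
Lemma Gamma_factor_cvg :
  n%:R `^ (4%:R^-1) * (2%:R `^ (4%:R^-1) * (Gamma (3%:R / 4%:R) * b34 n./2))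
    / Num.sqrt 2%:R @[n --> \oo] --> (1 : R).
Proof.
have p4 (x : R) : 0 <= x -> (x `^ (4%:R^-1)) ^+ 4 = x.
  by move=> x0; rewrite -powR_quarter divff ?powRr1 // pnatr_eq0.
have s4 : Num.sqrt 2%:R ^+ 4 = 4%:R :> R.
  by rewrite (exprM _ 2 2) sqr_sqrtr // -natrX.
apply/cvgrPdist_le => eps eps0; near=> n.
have n2 : (2 <= n)%N by near: n; exact: nbhs_infty_ge.
case nm : n./2 => [|m]; first by move: n2; rewrite -half_gt0 nm.
have me : (m.+1%:R^-1 : R) <= eps.
  rewrite -[eps]invrK lef_pV2 ?posrE ?ltr0n ?invr_gt0 //.
  apply: le_trans (ltW (archi_boundP _)) _; first by rewrite invr_ge0 ltW.
  rewrite ler_nat -nm geq_half_double; near: n; exact: nbhs_infty_ge.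
have /andP[] := Gamma34_binser_bounds R m.
set y := Gamma _ * _ => y1 y2.
have m1 : 0 < m.+1%:R :> R by rewrite ltr0n.
have y0 : 0 <= y.
  have : 0 < m.+2%:R `^ (4%:R^-1) * y by apply: lt_le_trans y2.
  by rewrite pmulr_rgt0 ?powR_gt0 ?ltr0n // => /ltW.
set t := _ / _; have t0 : 0 <= t.
  by apply: divr_ge0; rewrite ?sqrtr_ge0 // mulr_ge0 ?powR_ge0 // mulr_ge0 ?powR_ge0.
rewrite distrC; apply: le_trans (norm_sub1_le_pow4 t0) _; apply: le_trans me.
have tE : t ^+ 4 = n%:R * y ^+ 4 / 2%:R.
  rewrite /t expr_div_n s4 !exprMn !p4 //.
  by field.
have z1 : m.+1%:R * y ^+ 4 <= 1.
  rewrite -[m.+1%:R]p4 // -exprMn; apply: exprn_ile1 => //.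
  by apply: mulr_ge0 => //; exact: powR_ge0.
have z2 : 1 <= m.+2%:R * y ^+ 4.
  by rewrite -[m.+2%:R]p4 // -exprMn; apply: exprn_ege1.
have n1 : 2%:R * m.+1%:R <= n%:R :> R.
  by rewrite -natrM ler_nat mul2n -nm -geq_half_double.
have n3 : n%:R <= 2%:R * m.+1%:R + 1 :> R.
  by rewrite -natrM natr1 ler_nat -nm mul2n -[leqLHS]odd_double_half; case: odd.
have y40 : 0 <= y ^+ 4 by rewrite exprn_ge0.
have up : t ^+ 4 - 1 <= m.+1%:R^-1.
  rewrite tE -(ler_pM2l m1) mulfV ?gt_eqF //.
  move: (y ^+ 4) z1 y40 => Y z1 Y0; move: (m.+1%:R : R) (n%:R : R) m1 n1 n3 z1 => M N; nra.
have low : - m.+1%:R^-1 <= t ^+ 4 - 1.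
  rewrite tE -(ler_pM2l m1) mulrN mulfV ?gt_eqF //.
  move: z2; rewrite -[m.+2%:R]natr1.
  move: (y ^+ 4) z1 y40 => Y z1 Y0; move: (m.+1%:R : R) (n%:R : R) m1 n1 n3 z1 => M N; nra.
by rewrite ler_norml low.
Unshelve. all: by end_near. Qed.

Lemma atotal_asymptotics :
  (fun n : nat => (atotal n)%:R /
       ((4%:R : R) ^+ n * powR (n%:R : R) (- (4%:R)^-1)
          / (powR (2%:R : R) (4%:R)^-1 * Gamma (3%:R / 4%:R : R))))
     @ \oo --> (1 : R).
Proof.
have s0 : Num.sqrt 2%:R != 0 :> R by rewrite gt_eqF // sqrtr_gt0.
pose t n : R := n%:R `^ (4%:R^-1) * (2%:R `^ (4%:R^-1) * (Gamma (3%:R / 4%:R) * b34 n./2))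
    / Num.sqrt 2%:R.
have x_cvg : e n./2 / b34 n./2 @[n --> \oo] --> (Num.sqrt 2%:R)^-1 :=
  cvg_comp _ _ half_cvgn pair_ser_ratio_cvg.
suff -> : (fun n : nat => (atotal n)%:R /
       ((4%:R : R) ^+ n * powR (n%:R : R) (- (4%:R)^-1)
          / (powR (2%:R : R) (4%:R)^-1 * Gamma (3%:R / 4%:R : R)))) =
    (fun n => e n./2 / b34 n./2 * Num.sqrt 2%:R * t n).
  have c1 : e n./2 / b34 n./2 * Num.sqrt 2%:R @[n --> \oo] -->
      (Num.sqrt 2%:R)^-1 * Num.sqrt 2%:R.
    by apply: cvgM; [exact: x_cvg|exact: cvg_cst].
  have := cvgM c1 Gamma_factor_cvg; rewrite mulVf // mulr1; exact.
apply: funext => n; rewrite -atotal_pair_ser /t powRN.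
have b0 : b34 n./2 != 0 by rewrite gt_eqF // binser_gt0 // divr_gt0.
rewrite !invfM !invrK.
have cancel2 (x1 x2 x3 x4 x5 u v : R) : u != 0 -> v != 0 ->
    x5 * (x1 * x2 * (x3 * x4)) = x5 * x1 / u * v * (x2 * (x3 * (x4 * u)) / v).
  by move=> u0 v0; field; rewrite u0 v0.
exact: cancel2.
Qed.

End Limits.

Theorem mainTheorem2 (R : realType) :
  (* (1) closed form of S(x,y;t), with
         r = sqrt(1-16t^2),  q = (1 - 8t^2(1+xbar^2) + r)^{1/2} / sqrt 2
           = ((1 - 8t^2(1+xbar^2) + r)/2)^{1/2}   (radicals with constant term 1),
         and S * (1 - t(x+xbar)(y+ybar)) = q *)
  (exists r q : fps K,
      r 0%N = 1 /\ fps_mul r r = fps_of_poly (1 - 16%:R *: 'X^2) /\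
      q 0%N = 1 /\
      fps_mul q q =
        fps_scale 2^-1
          (fps_add (fps_of_poly (1 - (8%:R * (1 + xK^-1 ^+ 2)) *: 'X^2)) r) /\
      fps_mul Sser
        (fps_of_poly (1 - ((xK + xK^-1) * (yK + yK^-1)) *: 'X)) = q)
  /\
  (* (2) S is algebraic of degree 4 over Q(x,y,t) = Q(x,y)(t) *)
  ((exists P : {poly {poly K}}, size P = 5%N /\ fps_eval P Sser = fps_zero K) /\
   (forall P : {poly {poly K}}, P != 0 -> (size P <= 4)%N ->
      fps_eval P Sser <> fps_zero K))
  /\
  (* (3) S(1,1;t) = (1+4t)^{1/4} (1+sqrt(1-16t^2))^{1/2} / (sqrt 2 (1-4t)^{3/4}) *)
  (exists u v r w : fps rat,
      u 0%N = 1 /\ fps_pow u 4 = fps_of_poly (1 + 4%:R *: 'X) /\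
      v 0%N = 1 /\ fps_pow v 4 = fps_of_poly ((1 - 4%:R *: 'X) ^+ 3) /\
      r 0%N = 1 /\ fps_mul r r = fps_of_poly (1 - 16%:R *: 'X^2) /\
      w 0%N = 1 /\
      fps_mul w w = fps_scale 2^-1 (fps_add (fps_of_poly 1) r) /\
      fps_mul Aser v = fps_mul u w)
  /\
  (* (4) a(n) ~ 4^n n^{-1/4} / (2^{1/4} Gamma(3/4)) *)
  ((fun n : nat => (atotal n)%:R /
       ((4%:R : R) ^+ n * powR (n%:R : R) (- (4%:R)^-1)
          / (powR (2%:R : R) (4%:R)^-1 * Gamma (3%:R / 4%:R : R))))
     @ \oo --> (1 : R)).
Proof.
split; first exact: (walk_gf_closed_form xK_neq0 yK_neq0 evKX evKY).
split; first exact: (walk_gf_degree xK_neq0 yK_neq0 evKX evKY sqr_xK1_neq0).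
split; first exact: Aser_closed_form.
exact: atotal_asymptotics.
Qed.
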